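(* Let $\nu_0,\nu_1,\omega\ge 0$ and $p\ge 1$, and let $\hat p$ be the Hölder conjugate of $p$. For single-mode states $\rho$ with finite mean photon number let $$\Upsilon(\rho)=\hat p\,\big\langle \mathcal L(\rho^{1/p}),\rho^{1/\hat p}\big\rangle+\omega\,\mathrm{tr}(\rho\,\mathbf a^\dagger\mathbf a)+S(\rho),\qquad \mathcal L=\nu_0\mathcal L_0+\nu_1\mathcal L_1,$$ and let $$\eta_{\mathrm{th}}=\inf_{0<x<1}\Upsilon(\tau_x),\qquad \tau_x=(1-x)\sum_{n\ge0}x^n|n\rangle\langle n| ,$$ be the infimum of $\Upsilon$ over thermal states. Then for every single-mode quantum state $\rho$ with finite mean photon number, $$\Upsilon(\rho)\ge \eta_{\mathrm{th}}.$$
   Context: Single-mode bosonic system: a Hilbert space with orthonormal (Fock) basis $\{|n\rangle: n\ge0\}$, annihilation operator $\mathbf a|n\rangle=\sqrt n|n-1\rangle$, creation operator $\mathbf a^\dagger|n\rangle=\sqrt{n+1}|n+1\rangle$, so $[\mathbf a,\mathbf a^\dagger]=1$. A state is a positive semidefinite operator $\rho$ with $\mathrm{tr}(\rho)=1$. If $\rho=\sum_j\lambda_j|\psi_j\rangle\langle\psi_j|$ is an eigen-decomposition, $\rho$ has finite mean photon number if every $\psi_j$ with $\lambda_j>0$ is in the domain of $\mathbf a$ and $\mathrm{tr}(\rho\mathbf a^\dagger\mathbf a):=\sum_j\lambda_j\|\mathbf a\psi_j\|^2<\infty$; also $\mathrm{tr}(\rho\mathbf a\mathbf a^\dagger):=\sum_j\lambda_j\|\mathbf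 a^\dagger\psi_j\|^2$. $\frac1p+\frac1{\hat p}=1$ ($\hat p=+\infty$ if $p=1$); $S(\rho)=-\mathrm{tr}(\rho\log\rho)$ with natural logarithm; $\langle X,Y\rangle=\mathrm{tr}(X^\dagger Y)$; $$\mathcal L_0(X)=\tfrac12\{\mathbf a\mathbf a^\dagger,X\}-\mathbf a^\dagger X\mathbf a,\qquad \mathcal L_1(X)=\tfrac12\{\mathbf a^\dagger\mathbf a,X\}-\mathbf aX\mathbf a^\dagger,$$ where $\{X,Y\}=XY+YX$. For $p>1$ the first term of $\Upsilon$ is understood as $$\hat p\,\langle\mathcal L(\rho^{1/p}),\rho^{1/\hat p}\rangle=\hat p\Big(\nu_0\big[\mathrm{tr}(\rho\mathbf a\mathbf a^\dagger)-\mathrm{tr}(\rho^{1/p}\mathbf a\rho^{1/\hat p}\mathbf a^\dagger)\big]+\nu_1\big[\mathrm{tr}(\rho\mathbf a^\dagger\mathbf a)-\mathrm{tr}(\rho^{1/p}\mathbf a^\dagger\rho^{1/\hat p}\mathbf a)\big]\Big),$$ with $\mathrm{tr}(\rho^{1/p}\mathbf a\rho^{1/\hat p}\mathbf a^\dagger)=\sum_{i,j}\lambda_i^{1/p}\lambda_j^{1/\hat p}|\langle\psi_i|\mathbf a|\psi_j\rangle|^2$ and $\mathrm{tr}(\rho^{1/p}\mathbf a^\dagger\rho^{1/\hat p}\mathbf a)=\sum_{i,j}\lambda_i^{1/p}\lambda_j^{1/\hat p}|\langle\psi_j|\mathbf a|\psi_i\rangle|^2$; all terms are finite when the mean photon number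 is finite. For $p=1$, by convention, the first term is $\langle\mathcal L(\rho),\log\rho\rangle$, understood as the limit $$\lim_{q\to1^+}\hat q\Big(\nu_0\big[\mathrm{tr}(\rho\mathbf a\mathbf a^\dagger)-\mathrm{tr}(\rho^{1/q}\mathbf a\rho^{1/\hat q}\mathbf a^\dagger)\big]+\nu_1\big[\mathrm{tr}(\rho\mathbf a^\dagger\mathbf a)-\mathrm{tr}(\rho^{1/q}\mathbf a^\dagger\rho^{1/\hat q}\mathbf a)\big]\Big),\qquad \tfrac1q+\tfrac1{\hat q}=1$$ (a value in $(-\infty,+\infty]$). *)

(* Defs.v *)
From HB Require Import structures.
From mathcomp Require Import all_boot all_order all_algebra.
From mathcomp Require Import complex.
From mathcomp Require Import all_classical all_reals all_analysis.

Set Implicit Arguments.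
Unset Strict Implicit.
Unset Printing Implicit Defensive.

Import Order.TTheory GRing.Theory Num.Theory.
Import numFieldNormedType.Exports.

Local Open Scope classical_set_scope.
Local Open Scope ring_scope.

(* The single-mode Hilbert space is l^2(nat): phi n is the coefficient <n|phi>
   of phi in the Fock basis.  A ket is an arbitrary complex sequence;
   membership in the Hilbert space is the predicate [in_l2]. *)
Definition ket (R : realType) := nat -> R[i].

Definition sqmod (R : realType) (z : R[i]) : R :=
  complex.Re z ^+ 2 + complex.Im z ^+ 2.

Definition sqnorm (R : realType) (phi : ket R) : \bar R :=
  (\sum_(n <oo) (sqmod (phi n))%:E)%E.

Definition in_l2 (R : realType) (phi : ket R) : Prop := (sqnorm phi < +oo)%E.

Definition cseries (R : realType) (u : nat -> R[i]) : R[i] :=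
  Complex (limn (series (fun n => complex.Re (u n))))
          (limn (series (fun n => complex.Im (u n)))).

(* Conjugate-linear in the first argument; the series converges absolutely
   on in_l2. *)
Definition inner (R : realType) (phi chi : ket R) : R[i] :=
  cseries (fun n => conjc (phi n) * chi n).

Definition fock (R : realType) (n : nat) : ket R := fun m => (m == n)%:R.

(* Coefficients of a phi; phi belongs to the domain of a iff
   in_l2 (annih phi). *)
Definition annih (R : realType) (phi : ket R) : ket R :=
  fun n => real_complex R (Num.sqrt n.+1%:R) * phi n.+1.

(* The coefficient at n = 0 vanishes because of the factor sqrt 0. *)
Definition creat (R : realType) (phi : ket R) : ket R :=
  fun n => real_complex R (Num.sqrt n%:R) * phi n.-1.

(* An everywhere-defined linear operator on l^2; its values on sequences that
   are not square-summable are irrelevant.  Boundedness is not required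
   separately, as an everywhere-defined positive operator is bounded. *)
Definition l2_operator (R : realType) (A : ket R -> ket R) : Prop :=
  (forall phi, in_l2 phi -> in_l2 (A phi)) /\
  (forall (c : R[i]) (phi chi : ket R), in_l2 phi -> in_l2 chi ->
     A (fun n => c * phi n + chi n) = (fun n => c * A phi n + A chi n)).

(* In R[i], 0 <= z means that z is real and nonnegative. *)
Definition positive_semidefinite (R : realType) (A : ket R -> ket R) : Prop :=
  forall phi, in_l2 phi -> 0 <= inner phi (A phi).

(* For positive operators only: the real parts discard nothing. *)
Definition trace (R : realType) (A : ket R -> ket R) : \bar R :=
  (\sum_(n <oo)
     (complex.Re (inner (@fock R n) (A (@fock R n))))%:E)%E.

Definition state (R : realType) (rho : ket R -> ket R) : Prop :=
  [/\ l2_operator rho, positive_semidefinite rho & trace rho = 1%E].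

Definition orthonormal_family (R : realType) (psi : nat -> ket R) : Prop :=
  (forall j, in_l2 (psi j)) /\
  (forall i j, inner (psi i) (psi j) = (i == j)%:R).

(* rho = sum_j lam_j |psi_j><psi_j|, the series rho phi converging in norm for
   every phi.  The psi_j need not span the space, and some lam_j may vanish,
   so finite decompositions are covered by padding with zero eigenvalues. *)
Definition eigen_decomposition (R : realType) (rho : ket R -> ket R)
    (lam : nat -> R) (psi : nat -> ket R) : Prop :=
  orthonormal_family psi /\
  forall phi, in_l2 phi ->
    sqnorm (fun m => rho phi m -
      \sum_(j < N) real_complex R (lam j) * inner (psi j) phi * psi j m)
      @[N --> \oo] --> 0%E.

(* The functionals below take the eigenvalues lam and the eigenvectors psi of
   rho.  When lam j = 0 the corresponding terms vanish, even if psi j is not in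
   the domain of a, since 0 * +oo = 0 and 0 `^ x = 0 for x > 0. *)

(* tr (rho a^dag a) *)
Definition mean_photon (R : realType) (lam : nat -> R) (psi : nat -> ket R) :
    \bar R :=
  (\sum_(j <oo) (lam j)%:E * sqnorm (annih (psi j)))%E.

(* tr (rho a a^dag) *)
Definition mean_anti_photon (R : realType) (lam : nat -> R)
    (psi : nat -> ket R) : \bar R :=
  (\sum_(j <oo) (lam j)%:E * sqnorm (creat (psi j)))%E.

Definition finite_mean_photon (R : realType) (lam : nat -> R)
    (psi : nat -> ket R) : Prop :=
  (forall j, 0 < lam j -> in_l2 (annih (psi j))) /\
  (mean_photon lam psi < +oo)%E.

(* Used for 1 < p only. *)
Definition holder_conj (R : realType) (p : R) : R := p / (p - 1).

(* tr (rho^(1/p) a rho^(1/p^) a^dag) *)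
Definition cross_annih (R : realType) (p : R) (lam : nat -> R)
    (psi : nat -> ket R) : \bar R :=
  (\sum_(i <oo) \sum_(j <oo)
     (lam i `^ p^-1 * lam j `^ (holder_conj p)^-1
      * sqmod (inner (psi i) (annih (psi j))))%:E)%E.

(* tr (rho^(1/p) a^dag rho^(1/p^) a) *)
Definition cross_creat (R : realType) (p : R) (lam : nat -> R)
    (psi : nat -> ket R) : \bar R :=
  (\sum_(i <oo) \sum_(j <oo)
     (lam i `^ p^-1 * lam j `^ (holder_conj p)^-1
      * sqmod (inner (psi j) (annih (psi i))))%:E)%E.

(* p^ <L(rho^(1/p)), rho^(1/p^)> with L = nu0 L_0 + nu1 L_1, for 1 < p; all
   the terms are finite when the mean photon number is. *)
Definition dirichlet_gt1 (R : realType) (nu0 nu1 p : R) (lam : nat -> R)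
    (psi : nat -> ket R) : \bar R :=
  ((holder_conj p)%:E *
    (nu0%:E * (mean_anti_photon lam psi - cross_annih p lam psi)
     + nu1%:E * (mean_photon lam psi - cross_creat p lam psi)))%E.

Definition dirichlet (R : realType) (nu0 nu1 p : R) (lam : nat -> R)
    (psi : nat -> ket R) : \bar R :=
  if p == 1 then lim (dirichlet_gt1 nu0 nu1 q lam psi @[q --> (1 : R)^'+])
  else dirichlet_gt1 nu0 nu1 p lam psi.

(* - tr (rho log rho); ln 0 = 0 here, so zero eigenvalues contribute 0. *)
Definition entropy (R : realType) (lam : nat -> R) : \bar R :=
  (\sum_(j <oo) (- (lam j * ln (lam j)))%:E)%E.

Definition Upsilon (R : realType) (nu0 nu1 omega p : R) (lam : nat -> R)
    (psi : nat -> ket R) : \bar R :=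
  (dirichlet nu0 nu1 p lam psi + omega%:E * mean_photon lam psi
   + entropy lam)%E.

(* tau_x has eigenvalues (1 - x) x^n and eigenvectors |n>. *)
Definition thermal_eigenvalue (R : realType) (x : R) (n : nat) : R :=
  (1 - x) * x ^+ n.

(* An extended real, possibly -oo. *)
Definition eta_th (R : realType) (nu0 nu1 omega p : R) : \bar R :=
  ereal_inf [set Upsilon nu0 nu1 omega p (thermal_eigenvalue x) (@fock R)
            | x in [set x : R | 0 < x < 1]].

(* Main.v *)
(* Put M_ij = |<psi_i, a psi_j>|^2, b_j = |a psi_j|^2 and s = 1 - 1/p.  Bessel's
   inequality and |a^dag psi|^2 = |a psi|^2 + |psi|^2 turn M into a flow on the
   eigenvectors with net supply 1 at each node, eigenvalue 0 being the sink, and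
   the first term of the functional is the transportation cost of this flow for
     c(x,y) = (nu0 (x - x^(1-s) y^s) + nu1 (y - y^(1-s) x^s)) / s.
   Sort the eigenvalues decreasingly as l_0 >= l_1 >= ...  Since c is
   superadditive along decreasing chains, the potentials
   u_i = sum_(k >= i) c(l_k, l_(k+1)) are dual feasible, so the cost is at least
   sum_i u_i.  By Hoelder u_i >= c(T_i, T_(i+1)) with T_i = sum_(k >= i) l_k; the
   entropy is sum_i T_i h(T_(i+1)/T_i) by the chain rule, and
   tr (rho a^dag a) >= sum_i T_(i+1).  Hence the functional is at least
   sum_i T_i G(q_i) with q_i = T_(i+1)/T_i, where G(x) / (1 - x) is its value at
   tau_x; as T_i (1 - q_i) = l_i, this is at least eta_th.
   The argument runs on finite truncations of the spectrum.  For p = 1 the first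
   term increases as s decreases to 0 (Young), and the limit is exchanged with
   the infimum over x by an estimate uniform in x. *)

Require Import Defs.
From mathcomp Require Import all_boot all_order all_algebra.
From mathcomp Require Import complex.
From mathcomp Require Import all_classical all_reals all_analysis.
From mathcomp Require Import ring lra.

Set Implicit Arguments.
Unset Strict Implicit.
Unset Printing Implicit Defensive.

Import Order.TTheory GRing.Theory Num.Theory.
Import numFieldNormedType.Exports.
Local Open Scope classical_set_scope.
Local Open Scope ring_scope.

(** * The transportation problem between eigenvalues *)

Section weighted_geometric_mean.
Context {R : realType}.
Implicit Types (s a b c d : R).

(** The weight [s] sits on the second argument: for [s = 1 - 1/p] this is a^(1/p) b^(1/p^), the
    coefficient in the cross terms. *)
Definition wgm s a b : R := a `^ (1 - s) * b `^ s.

Lemma wgm_ge0 s a b : 0 <= wgm s a b.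
Proof. by rewrite mulr_ge0 ?powR_ge0. Qed.

Lemma wgm_diag s a : 0 <= a -> wgm s a a = a.
Proof.
by move=> a0; rewrite /wgm -powRD ?subrK ?oner_eq0// powRr1.
Qed.

Lemma wgm0l s b : s < 1 -> wgm s 0 b = 0.
Proof. by move=> s1; rewrite /wgm powR0 ?mul0r// gt_eqF// subr_gt0. Qed.

Lemma wgm0r s a : 0 < s -> wgm s a 0 = 0.
Proof. by move=> s0; rewrite /wgm powR0 ?mulr0// gt_eqF. Qed.

Lemma wgmM s a b c d : 0 <= a -> 0 <= b -> 0 <= c -> 0 <= d ->
  wgm s (a * c) (b * d) = wgm s a b * wgm s c d.
Proof. by move=> *; rewrite /wgm !powRM// mulrACA. Qed.

(** Young's inequality for a^(1-s) and b^s with the conjugate exponents [(1 - s)^-1] and [s^-1]. *)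
Lemma wgm_young s a b : 0 < s < 1 -> 0 <= a -> 0 <= b ->
  wgm s a b <= (1 - s) * a + s * b.
Proof.
move=> /andP[s0 s1] a0 b0.
have t0 : 0 < 1 - s by rewrite subr_gt0.
have := @conjugate_powR R (a `^ (1 - s)) (b `^ s) (1 - s)^-1 s^-1.
rewrite !powR_ge0 !invr_gt0 t0 s0 !invrK subrK => /(_ isT isT isT isT erefl).
by rewrite -!powRrM !mulfV ?gt_eqF// !powRr1// [a * _]mulrC [b * _]mulrC.
Qed.

Lemma wgm_wgm s t a b : 0 < t * s < 1 -> 0 <= a ->
  wgm t a (wgm s a b) = wgm (t * s) a b.
Proof.
move=> /andP[ts0 ts1] a0; rewrite /wgm powRM ?powR_ge0// -!powRrM mulrA.
rewrite -powRD; first by congr (_ `^ _ * _ `^ _); ring.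
(* At base 0, [powRD] asks for a nonzero exponent sum; here it is [1 - t * s > 0]. *)
by apply/implyP => /eqP h; exfalso; move: h ts1; nra.
Qed.

(** Hölder for two terms: after division by the totals [a + c] and [b + d], Young bounds the two
    means by numbers adding up to 1. *)
Lemma wgm_superadd s a b c d : 0 < s < 1 ->
  0 <= a -> 0 <= b -> 0 <= c -> 0 <= d ->
  wgm s a b + wgm s c d <= wgm s (a + c) (b + d).
Proof.
move=> s01 a0 b0 c0 d0; have /andP[s0 s1] := s01.
have [ac0|ac0] := eqVneq (a + c) 0.
  have -> : a = 0 by apply/eqP; rewrite eq_le a0 andbT; lra.
  have -> : c = 0 by apply/eqP; rewrite eq_le c0 andbT; lra.
  by rewrite addr0 !wgm0l// addr0.
have [bd0|bd0] := eqVneq (b + d) 0.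
  have -> : b = 0 by apply/eqP; rewrite eq_le b0 andbT; lra.
  have -> : d = 0 by apply/eqP; rewrite eq_le d0 andbT; lra.
  by rewrite addr0 !wgm0r// addr0.
have A0 : 0 <= a + c by rewrite addr_ge0.
have B0 : 0 <= b + d by rewrite addr_ge0.
have scale x y : 0 <= x -> 0 <= y ->
    wgm s x y = wgm s (a + c) (b + d) * wgm s (x / (a + c)) (y / (b + d)).
  by move=> x0 y0; rewrite -wgmM ?divr_ge0// !(mulrC _ (_ / _)) !divfK.
rewrite (scale a b)// (scale c d)// -mulrDr -[leRHS]mulr1.
rewrite ler_wpM2l ?wgm_ge0//.
have ha := @wgm_young s (a / (a + c)) (b / (b + d)) s01.
have hc := @wgm_young s (c / (a + c)) (d / (b + d)) s01.
have := lerD (ha _ _) (hc _ _); rewrite !divr_ge0// => /(_ isT isT isT isT).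
move=> /le_trans; apply.
rewrite addrACA -!mulrDr -!mulrDl !mulfV//; lra.
Qed.

Lemma wgm_sum s (I : Type) (r : seq I) (f g : I -> R) : 0 < s < 1 ->
  (forall i, 0 <= f i) -> (forall i, 0 <= g i) ->
  \sum_(i <- r) wgm s (f i) (g i) <= wgm s (\sum_(i <- r) f i) (\sum_(i <- r) g i).
Proof.
move=> s01 f0 g0; elim: r => [|i r ih]; first by rewrite !big_nil wgm_ge0.
rewrite !big_cons (le_trans (lerD (lexx _) ih))//.
by rewrite wgm_superadd// sumr_ge0.
Qed.

End weighted_geometric_mean.

Section cost.
Context {R : realType} (nu0 nu1 s : R).
Hypotheses (hnu0 : 0 <= nu0) (hnu1 : 0 <= nu1) (s01 : 0 < s < 1).
Implicit Types a b d : R.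

Let s0 : 0 < s. Proof. by case/andP: s01. Qed.
Let s1 : s < 1. Proof. by case/andP: s01. Qed.

Definition cost a b : R :=
  s^-1 * (nu0 * (a - wgm s a b) + nu1 * (b - wgm s b a)).

Lemma cost_a0 a : cost a 0 = s^-1 * (nu0 * a).
Proof. by rewrite /cost wgm0l// wgm0r// !subr0 mulr0 addr0. Qed.

Lemma cost_0b b : cost 0 b = s^-1 * (nu1 * b).
Proof. by rewrite /cost wgm0l// wgm0r// !subr0 mulr0 add0r. Qed.

(** Young in both summands. This linear bound telescopes, which handles moves from a smaller to a
    larger eigenvalue. *)
Lemma cost_ge a b : 0 <= a -> 0 <= b -> (nu0 - nu1) * (a - b) <= cost a b.
Proof.
move=> a0 b0; rewrite /cost [leRHS]mulrC ler_pdivlMr//.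
have := ler_wpM2l hnu0 (wgm_young s01 a0 b0).
have := ler_wpM2l hnu1 (wgm_young s01 b0 a0).
by move=> h1 h2; nra.
Qed.

(** Each half expands a product of two nonnegative differences, such as (a^(1-s) - b^(1-s)) (b^s -
    d^s) >= 0, using b^(1-s) b^s = b. *)
Lemma cost_chain a b d : 0 <= d -> d <= b -> b <= a ->
  cost a b + cost b d <= cost a d.
Proof.
move=> d0 db ba; have b0 := le_trans d0 db; have a0 := le_trans b0 ba.
have pw x y r : 0 <= r -> 0 <= x -> x <= y -> x `^ r <= y `^ r.
  by move=> r0 x0 xy; rewrite ge0_ler_powR// nnegrE// (le_trans x0).
have s0' := ltW s0; have t0 : 0 <= 1 - s by rewrite subr_ge0 ltW.
have b_E : b `^ (1 - s) * b `^ s = b by exact: wgm_diag.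
rewrite /cost -mulrDr ler_pM2l ?invr_gt0//.
have h0 : wgm s a d + b <= wgm s a b + wgm s b d.
  rewrite /wgm -{1}b_E.
  have := mulr_ge0 (_ : 0 <= a `^ (1 - s) - b `^ (1 - s))
                   (_ : 0 <= b `^ s - d `^ s).
  by rewrite !subr_ge0 !pw// => /(_ isT isT); nra.
have h1 : wgm s d a + b <= wgm s b a + wgm s d b.
  rewrite /wgm -{1}b_E.
  have := mulr_ge0 (_ : 0 <= b `^ (1 - s) - d `^ (1 - s))
                   (_ : 0 <= a `^ s - b `^ s).
  by rewrite !subr_ge0 !pw// => /(_ isT isT); nra.
have := ler_wpM2l hnu0 h0; have := ler_wpM2l hnu1 h1.
lra.
Qed.

(** Homogeneity of degree 1; the factor depending on [q] is the first summand of
    [thermal_value s q]. *)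
Lemma costZ a q : 0 <= a -> 0 <= q ->
  cost a (a * q) = a * (s^-1 * (nu0 * (1 - q `^ s) + nu1 * (q - q `^ (1 - s)))).
Proof.
move=> a0 q0; rewrite /cost.
have := wgmM s a0 a0 ler01 q0; have := wgmM s a0 a0 q0 ler01.
by rewrite !mulr1 wgm_diag// => -> ->; rewrite /wgm !powR1; ring.
Qed.

(** Hölder makes both geometric means superadditive, and they enter [cost] with a minus sign. *)
Lemma cost_sum (I : Type) (r : seq I) (f g : I -> R) :
  (forall i, 0 <= f i) -> (forall i, 0 <= g i) ->
  cost (\sum_(i <- r) f i) (\sum_(i <- r) g i)
    <= \sum_(i <- r) cost (f i) (g i).
Proof.
move=> f0 g0; rewrite /cost -mulr_sumr ler_pM2l ?invr_gt0//.
rewrite big_split/= -!mulr_sumr !sumrB lerD// ler_wpM2l// lerB// wgm_sum//.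
Qed.

Section flow.
Variables (l : nat -> R) (K : nat).
Hypothesis l_ge0 : forall k, 0 <= l k.
Hypothesis l_anti : forall i j, (i <= j)%N -> l j <= l i.
Hypothesis l_K : forall k, (K <= k)%N -> l k = 0.

(* Dual potential of the transportation problem: the cost of descending from
   node [i] to the sink along the chain of decreasing eigenvalues. *)
Definition pot i : R := \sum_(i <= k < K) cost (l k) (l k.+1).

Lemma cost_path i j : (i <= j)%N ->
  \sum_(i <= k < j) cost (l k) (l k.+1) <= cost (l i) (l j).
Proof.
move=> ij; rewrite -(subnKC ij); elim: (j - i)%N => [|n ih].
  by rewrite addn0 big_geq// /cost !wgm_diag// !subrr !mulr0 addr0 mulr0.
rewrite addnS big_nat_recr ?leq_addr//=.
rewrite (le_trans (lerD ih (lexx _)))//.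
by rewrite cost_chain// l_anti// leq_addr.
Qed.

(** Dual feasibility, with index [K] as the sink. Downwards it is superadditivity along the chain;
    upwards both the edge and the reversed chain are compared with the linear bound [cost_ge]. *)
Lemma pot_sub i j : (i <= K)%N -> (j <= K)%N ->
  pot i - pot j <= cost (l i) (l j).
Proof.
move=> iK jK; have [ij|/ltnW ji] := leqP i j.
  by rewrite /pot (big_cat_nat ij)//= addrK cost_path.
rewrite /pot [X in _ - X](big_cat_nat ji)//= opprD addrCA subrr addr0.
apply: le_trans (cost_ge _ _) => //.
rewrite lerNl -mulrN opprB.
suff : (nu0 - nu1) * (l j - l i) = \sum_(j <= k < i) (nu0 - nu1) * (l k - l k.+1).
  by move=> ->; rewrite ler_sum_nat// => k _; exact: cost_ge.
rewrite -mulr_sumr; congr (_ * _); rewrite -[LHS]opprB -telescope_sumr//.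
by rewrite -sumrN; apply: eq_bigr => k _; rewrite opprB.
Qed.

(** Weak duality. The slack of row [i] is sent to the sink and the slack of column [j] comes from
    the sink, so outflow [b i + 1] and inflow [b i] leave a net supply 1 at each node. *)
Lemma flow_bound (M : nat -> nat -> R) (b : nat -> R) :
  (forall i j, (i < K)%N -> (j < K)%N -> 0 <= M i j) ->
  (forall i, (i < K)%N -> \sum_(j < K) M i j <= b i + 1) ->
  (forall j, (j < K)%N -> \sum_(i < K) M i j <= b j) ->
  \sum_(i < K) pot i <= s^-1 *
   (nu0 * (\sum_(i < K) l i * (b i + 1)
           - \sum_(i < K) \sum_(j < K) wgm s (l i) (l j) * M i j)
  + nu1 * (\sum_(i < K) l i * b i
           - \sum_(i < K) \sum_(j < K) wgm s (l i) (l j) * M j i)).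
Proof.
move=> M0 Mout Min.
have potK : pot K = 0 by rewrite /pot big_geq.
have out : \sum_(i < K) (b i + 1 - \sum_(j < K) M i j) * pot i
   <= \sum_(i < K) (b i + 1 - \sum_(j < K) M i j) * cost (l i) 0.
  apply: ler_sum => i _; rewrite ler_wpM2l ?subr_ge0 ?Mout//.
  by have := pot_sub (ltnW (ltn_ord i)) (leqnn K); rewrite potK subr0 (l_K (leqnn K)).
have inn : \sum_(j < K) (b j - \sum_(i < K) M i j) * - pot j
   <= \sum_(j < K) (b j - \sum_(i < K) M i j) * cost 0 (l j).
  apply: ler_sum => i _; rewrite ler_wpM2l ?subr_ge0 ?Min//.
  by have := pot_sub (leqnn K) (ltnW (ltn_ord i)); rewrite potK sub0r (l_K (leqnn K)).
have mid : \sum_(i < K) \sum_(j < K) M i j * (pot i - pot j)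
   <= \sum_(i < K) \sum_(j < K) M i j * cost (l i) (l j).
  apply: ler_sum => i _; apply: ler_sum => j _.
  by rewrite ler_wpM2l ?M0// pot_sub// ltnW.
have := lerD (lerD out inn) mid.
(* Net supply 1 at each node and potential 0 at the sink: the potential drops weighted by the flow
   add up to the sum of the potentials. *)
have -> : \sum_(i < K) (b i + 1 - \sum_(j < K) M i j) * pot i
    + \sum_(j < K) (b j - \sum_(i < K) M i j) * - pot j
    + \sum_(i < K) \sum_(j < K) M i j * (pot i - pot j) = \sum_(i < K) pot i.
  have -> : \sum_(i < K) \sum_(j < K) M i j * (pot i - pot j) =
     \sum_(i < K) (\sum_(j < K) M i j) * pot i
     - \sum_(j < K) (\sum_(i < K) M i j) * pot j.
    under eq_bigr do under eq_bigr do rewrite mulrBr.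
    under eq_bigr do rewrite sumrB.
    rewrite sumrB; congr (_ - _); first by apply: eq_bigr => i _; rewrite mulr_suml.
    by rewrite exchange_big/=; apply: eq_bigr => i _; rewrite mulr_suml.
  rewrite -sumrB -!big_split/=; apply: eq_bigr => i _; ring.
(* The remaining claim is an identity: the right-hand side is the total cost, regrouped. *)
move=> /le_trans; apply; rewrite le_eqVlt; apply/orP; left; apply/eqP.
have -> : \sum_(i < K) \sum_(j < K) wgm s (l i) (l j) * M j i
   = \sum_(i < K) \sum_(j < K) wgm s (l j) (l i) * M i j.
  by rewrite exchange_big.
have -> : \sum_(i < K) \sum_(j < K) M i j * cost (l i) (l j) =
  s^-1 * (nu0 * (\sum_(i < K) (\sum_(j < K) M i j) * l i
               - \sum_(i < K) \sum_(j < K) wgm s (l i) (l j) * M i j)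
  + nu1 * (\sum_(j < K) (\sum_(i < K) M i j) * l j
           - \sum_(i < K) \sum_(j < K) wgm s (l j) (l i) * M i j)).
  under [X in nu1 * (X - _)]eq_bigr do rewrite mulr_suml.
  under [X in nu0 * (X - _)]eq_bigr do rewrite mulr_suml.
  rewrite [X in nu1 * (X - _)]exchange_big/= -!sumrB !mulr_sumr -big_split/= mulr_sumr.
  apply: eq_bigr => i _.
  rewrite -!sumrB !mulr_sumr -big_split/= mulr_sumr; apply: eq_bigr => j _.
  by rewrite /cost; ring.
under eq_bigr do rewrite cost_a0.
under [X in _ + X + _]eq_bigr do rewrite cost_0b.
rewrite !mulrBr !mulrDr.
have -> : \sum_(i < K) (b i + 1 - \sum_(j < K) M i j) * (s^-1 * (nu0 * l i)) =
   s^-1 * (nu0 * (\sum_(i < K) l i * (b i + 1) - \sum_(i < K) (\sum_(j < K) M i j) * l i)).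
  by rewrite -sumrB !mulr_sumr; apply: eq_bigr => i _; ring.
have -> : \sum_(i < K) (b i - \sum_(j < K) M j i) * (s^-1 * (nu1 * l i)) =
   s^-1 * (nu1 * (\sum_(i < K) l i * b i - \sum_(i < K) (\sum_(j < K) M j i) * l i)).
  by rewrite -sumrB !mulr_sumr; apply: eq_bigr => i _; ring.
ring.
Qed.

Definition tail n : R := \sum_(n <= k < K) l k.

Lemma tail_recl n : tail n = l n + tail n.+1.
Proof.
have [nK|Kn] := ltnP n K; first by rewrite /tail big_ltn.
by rewrite /tail !big_geq// ?l_K ?addr0// (leq_trans Kn).
Qed.

Lemma tail_ge0 n : 0 <= tail n.
Proof. by rewrite sumr_ge0. Qed.

(** Subadditivity of the cost along the chain from [n]: the targets [l k.+1] add up to [tail n.+1]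
    because [l K = 0]. *)
Lemma pot_ge n : cost (tail n) (tail n.+1) <= pot n.
Proof.
suff -> : tail n.+1 = \sum_(n <= k < K) l k.+1 by exact: cost_sum.
have [nK|Kn] := ltnP n K; last by rewrite /tail !big_geq// (leq_trans Kn).
have -> : tail n.+1 = \sum_(n.+1 <= k < K.+1) l k.
  by rewrite big_nat_recr//= l_K// addr0.
by rewrite big_add1.
Qed.

(** Abel summation: [l j] occurs in the [j] tails with indices 1 to [j]. *)
Lemma sum_tail : \sum_(n < K) tail n.+1 = \sum_(j < K) j%:R * l j.
Proof.
have h N : \sum_(n < N) tail n.+1 = \sum_(j < N) j%:R * l j + N%:R * tail N.
  elim: N => [|N ih]; first by rewrite !big_ord0 mul0r addr0.
  by rewrite !big_ord_recr/= ih (tail_recl N) -natr1; ring.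
by rewrite h [X in _ * X]big_geq// mulr0 addr0.
Qed.

End flow.

End cost.

(** * Thermal values *)

Section binary_entropy.
Context {R : realType}.
Implicit Types x y m : R.

Definition hbin x : R := - ((1 - x) * ln (1 - x)) - x * ln x.

Lemma opp_ln_le x : 0 < x -> - ln x <= x^-1 - 1.
Proof.
move=> x0; rewrite -lnV ?posrE//.
have := @le_ln1Dx R (x^-1 - 1); rewrite addrCA subrr addr0; apply.
by rewrite -subr_gt0 opprK subrK invr_gt0.
Qed.

Lemma xlnx_le0 x : 0 <= x <= 1 -> x * ln x <= 0.
Proof. by move=> /andP[x0 x1]; rewrite mulr_ge0_le0// ln_le0. Qed.

Lemma hbin_ge0 x : 0 <= x <= 1 -> 0 <= hbin x.
Proof.
move=> x01; rewrite /hbin addr_ge0// oppr_ge0 xlnx_le0//.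
by move: x01 => /andP[? ?]; apply/andP; split; lra.
Qed.

(** At a square, [- ln y <= y^-1 - 1] already gives a rate that vanishes with [y]; this serves as
    continuity of [hbin] at 0. *)
Lemma hbin_sqr_le y : 0 < y < 1 -> hbin (y ^+ 2) <= 3 * y.
Proof.
move=> /andP[y0 y1]; rewrite /hbin.
have y2 : y ^+ 2 < y by rewrite expr2 gtr_pMr.
have z0 : 0 < 1 - y ^+ 2 by lra.
have hA := ler_wpM2l (ltW z0) (opp_ln_le z0).
have hB := ler_wpM2l (ltW (mulr_gt0 y0 y0)) (opp_ln_le y0).
have eA : (1 - y ^+ 2) * ((1 - y ^+ 2)^-1 - 1) = y ^+ 2 by field; rewrite gt_eqF.
have eB : y * y * (y^-1 - 1) = y - y ^+ 2 by field; rewrite gt_eqF.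
by rewrite eA in hA; rewrite eB in hB; rewrite lnXn// mulr2n; nra.
Qed.

(** Entropy chain rule for splitting [l] off a remaining mass [T]; the terms [T * ln T] telescope
    when it is iterated. *)
Lemma hbin_chain (l T : R) : 0 < l -> l <= T ->
  - (l * ln l) = T * hbin ((T - l) / T) - T * ln T + (T - l) * ln (T - l).
Proof.
move=> l0 lT; have T0 := lt_le_trans l0 lT.
have e1 : 1 - (T - l) / T = l / T by field; rewrite gt_eqF.
rewrite /hbin e1 ln_div ?posrE//.
have [e|Tl] := eqVneq T l.
  by rewrite e !subrr !mul0r !mulr0 subr0; ring.
have Tl0 : 0 < T - l by rewrite subr_gt0 lt_neqAle eq_sym Tl.
by rewrite ln_div ?posrE//; field; rewrite gt_eqF.
Qed.

(** The limit [x -> 0] of the hypothesis, taken along squares [x = y ^+ 2]. *)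
Lemma le_of_hbin_bound m C om :
  (forall x, 0 < x < 1 -> m * (1 - x) <= C + om * x + hbin x) -> m <= C.
Proof.
move=> h; apply/ler_addgt0Pr => e e0.
(* The three error terms at [y ^+ 2] are at most |m| y, |om| y and 3 y. *)
set D := `|m| + `|om| + 3.
have D0 : 0 < D by rewrite ltr_wpDl// addr_ge0.
pose y := Num.min (2^-1) (e / D).
have y0 : 0 < y by rewrite lt_min invr_gt0 ltr0n divr_gt0.
have y1 : y < 1.
  by apply: (@le_lt_trans _ _ 2^-1); [rewrite ge_min lexx | lra].
have yD : y * D <= e by rewrite -ler_pdivlMr// ge_min lexx orbT.
have y2 : y ^+ 2 < y by rewrite expr2 gtr_pMr.
have y20 : 0 < y ^+ 2 by rewrite exprn_gt0.
have := h (y ^+ 2); rewrite y20 (lt_trans y2)// => /(_ isT).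
have := hbin_sqr_le (introT andP (conj y0 y1)).
have h1 : m * y ^+ 2 <= `|m| * y.
  by apply: (le_trans (ler_norm _)); rewrite normrM (gtr0_norm y20) ler_wpM2l// ltW.
have h2 : om * y ^+ 2 <= `|om| * y.
  by apply: (le_trans (ler_norm _)); rewrite normrM (gtr0_norm y20) ler_wpM2l// ltW.
rewrite /D in yD; nra.
Qed.

End binary_entropy.

Section thermal_function.
Context {R : realType} (nu0 nu1 om : R).
Hypotheses (hnu0 : 0 <= nu0) (hnu1 : 0 <= nu1) (hom : 0 <= om).
Implicit Types s x y m : R.

(* [(1 - x)] times the value of the functional at [tau_x], for
   [s = 1 - 1/p]. *)
Definition thermal_value s x : R :=
  s^-1 * (nu0 * (1 - x `^ s) + nu1 * (x - x `^ (1 - s))) + om * x + hbin x.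

(* The limit [s -> 0], i.e. [p = 1]. *)
Definition thermal_value0 x : R :=
  (nu1 * x - nu0) * ln x + om * x + hbin x.

Section fixed_exponent.
Variable s : R.
Hypothesis s01 : 0 < s < 1.

Let s0 : 0 < s. Proof. by case/andP: s01. Qed.
Let s1 : s < 1. Proof. by case/andP: s01. Qed.

(** The inequality [expR u >= 1 + u], at [u = s * ln x] for the [nu0] part and at [u = - s * ln x]
    for the [nu1] part. *)
Lemma thermal_value_le0 x : 0 < x < 1 -> thermal_value s x <= thermal_value0 x.
Proof.
move=> /andP[x0 x1]; rewrite /thermal_value /thermal_value0 !lerD2r.
rewrite ler_pdivrMl//.
have /(ler_wpM2l hnu0) h0 : 1 - x `^ s <= - (s * ln x).
  by rewrite /powR gt_eqF//; have := expR_ge1Dx (s * ln x); lra.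
have /(ler_wpM2l hnu1) h1 : x - x `^ (1 - s) <= x * (s * ln x).
  rewrite powRB ?gt_eqF ?implybT// powRr1 ?(ltW x0)// -powRN.
  rewrite -{1}[x]mulr1 -mulrBr ler_wpM2l ?(ltW x0)//.
  by rewrite /powR gt_eqF//; have := expR_ge1Dx (- s * ln x); lra.
lra.
Qed.

(** The point 0 matters because the last ratio of consecutive tail sums is 0. There the value is
    [s^-1 * nu0], and on ]0, 1[ it is at most [s^-1 * nu0 + om * x + hbin x]. *)
Lemma thermal_value_bound0 m :
  (forall x, 0 < x < 1 -> m * (1 - x) <= thermal_value s x) ->
  forall x, 0 <= x < 1 -> m * (1 - x) <= thermal_value s x.
Proof.
move=> h x /andP[]; rewrite le_eqVlt => /predU1P[<- _|x0 x1]; last first.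
  by apply: h; rewrite x0.
have -> : thermal_value s 0 = s^-1 * nu0.
  rewrite /thermal_value /hbin subr0 ln1 !powR0 ?gt_eqF ?subr_gt0//; ring.
rewrite subr0 mulr1.
apply: (@le_of_hbin_bound _ m (s^-1 * nu0) om) => {}x /andP[x0 x1].
apply: (le_trans (h x _)); first by rewrite x0.
rewrite !lerD2r ler_pM2l ?invr_gt0//.
have a0 : 0 <= x `^ s by exact: powR_ge0.
have a1 : x <= x `^ (1 - s).
  by rewrite ger1_powR ?x0 ?ltW//=; move: s0; lra.
have := mulr_ge0 hnu0 a0; have := ler_wpM2l hnu1 a1; nra.
Qed.

(* [pot_ge] replaces each chain by the single edge between consecutive tail
   sums, and the chain rule splits the entropy along the same ratios. *)
Lemma chain_bound m (l : nat -> R) K :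
  (forall x, 0 <= x < 1 -> m * (1 - x) <= thermal_value s x) ->
  (forall i j, (i <= j)%N -> l j <= l i) ->
  (forall k, (k < K)%N -> 0 < l k) -> (forall k, (K <= k)%N -> l k = 0) ->
  \sum_(k < K) l k <= 1 ->
  m * \sum_(k < K) l k <=
    \sum_(i < K) pot nu0 nu1 s l K i + om * (\sum_(j < K) j%:R * l j)
    + \sum_(j < K) - (l j * ln (l j)).
Proof.
move=> hm anti pos null le1.
have l0 k : 0 <= l k by have [/pos/ltW|/null->] := ltnP k K.
pose T := tail l K.
have T0 k : 0 <= T k by exact: tail_ge0.
have TS k : T k = l k + T k.+1 by exact: tail_recl.
have T0E : T 0%N = \sum_(k < K) l k by rewrite /T /tail big_mkord.
have TK : T K = 0 by rewrite /T /tail big_geq.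
have telB (f : nat -> R) : \sum_(n < K) (f n - f n.+1) = f 0%N - f K.
  rewrite -(big_mkord xpredT (fun n => f n - f n.+1)) -[RHS]opprB -telescope_sumr//.
  by rewrite -sumrN; apply: eq_bigr => ? _; rewrite opprB.
(* Summing [hbin_chain] leaves the boundary term [- (T 0 * ln (T 0))], which is nonnegative as
   [T 0 <= 1]. *)
have entE : \sum_(j < K) - (l j * ln (l j))
    = \sum_(n < K) T n * hbin (T n.+1 / T n) - T 0%N * ln (T 0%N).
  have := telB (fun n => T n * ln (T n)); rewrite TK mul0r subr0 => <-.
  rewrite -sumrB; apply: eq_bigr => n _.
  have e : T n.+1 = T n - l n by rewrite (TS n); ring.
  rewrite (@hbin_chain R (l n) (T n)) ?pos//; last by rewrite (TS n) lerDl.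
  by rewrite e; ring.
have ent : \sum_(n < K) T n * hbin (T n.+1 / T n) <= \sum_(j < K) - (l j * ln (l j)).
  by rewrite entE lerDl oppr_ge0 xlnx_le0// T0 T0E le1.
have pt : \sum_(n < K) cost nu0 nu1 s (T n) (T n.+1) <= \sum_(i < K) pot nu0 nu1 s l K i.
  by apply: ler_sum => i _; exact: pot_ge.
rewrite -(sum_tail null); apply: (le_trans _ (lerD (lerD pt (lexx _)) ent)).
(* Once [m * T 0] is telescoped, the inequality holds termwise, by the hypothesis at the ratio
   [T n.+1 / T n]. *)
rewrite -T0E -[T 0%N]subr0 -{1}TK -telB !mulr_sumr -!big_split/=.
apply: ler_sum => n _.
have Tn : 0 < T n by rewrite (TS n) ltr_wpDr ?pos.
have q0 : 0 <= T n.+1 / T n by rewrite divr_ge0.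
have q1 : T n.+1 / T n < 1.
  by rewrite ltr_pdivrMr// mul1r (TS n) ltrDr pos.
have := hm (T n.+1 / T n); rewrite q0 q1 => /(_ isT).
move=> /(ler_wpM2l (ltW Tn)).
have -> : T n * (m * (1 - T n.+1 / T n)) = m * (T n - T n.+1).
  by field; rewrite gt_eqF.
move=> /le_trans; apply; rewrite /thermal_value 2!mulrDr.
rewrite -costZ ?T0// !lerD//.
  by rewrite [_ * (_ / _)]mulrC divfK ?gt_eqF.
by rewrite -/T le_eqVlt; apply/orP; left; apply/eqP; field; rewrite gt_eqF.
Qed.

End fixed_exponent.

(** For [u = - (s * ln x) >= 0]: (1 - u + u^2)(1 + u) = 1 + u^3 >= 1, while [expR u >= 1 + u]. *)
Lemma powR_le_taylor x s : 0 < x <= 1 -> 0 <= s -> x `^ s <= 1 + s * ln x + (s * ln x) ^+ 2.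
Proof.
move=> /andP[x0 x1] s0; rewrite /powR gt_eqF//; set u := - (s * ln x).
have u0 : 0 <= u by rewrite /u -mulrN mulr_ge0// oppr_ge0 ln_le0.
have -> : s * ln x = - u by rewrite /u opprK.
rewrite expRN sqrrN -[leLHS]mul1r ler_pdivrMr ?expR_gt0//.
have := ler_wpM2l (_ : 0 <= 1 + - u + u ^+ 2) (expR_ge1Dx u).
by rewrite (_ : 0 <= _) => [/(_ isT)|]; nra.
Qed.

(** For [u = - (s * ln x)] in [0, 1/2]: (1 - u) expR u <= 1, while (1 + u + 2 u^2)(1 - u) = 1 + u^2
    (1 - 2 u) >= 1. *)
Lemma powRN_le_taylor x s : 0 < x <= 1 -> 0 <= s -> - (s * ln x) <= 2^-1 ->
  x `^ (- s) <= 1 - s * ln x + 2 * (s * ln x) ^+ 2.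
Proof.
move=> /andP[x0 x1] s0; rewrite /powR gt_eqF// mulNr.
have : 0 <= - (s * ln x) by rewrite -mulrN mulr_ge0// oppr_ge0 ln_le0.
rewrite -[in X in _ -> _ -> _ <= X](sqrrN (s * _)); move: (- (s * _)) => u u0 u2.
have := expR_ge1Dx (- u); rewrite expRN => h.
have e0 := expR_gt0 u.
have h1 : (1 - u) * expR u <= 1.
  by rewrite -ler_pdivlMr// div1r.
have : expR u * (1 - u) <= (1 + u + 2 * u ^+ 2) * (1 - u) by nra.
by rewrite ler_pM2r//; lra.
Qed.

(* Near [x = 0] the [nu0] term blows up; if [nu0 = 0], then [m <= 0]. *)
Lemma thermal_value_near0 m e : 0 < e ->
  (forall x, 0 < x < 1 -> m * (1 - x) <= thermal_value0 x) ->
  exists2 d, 0 < d <= 2^-1 & forall s x, 0 < s <= d / 2 -> 0 <= x < d ->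
    (m - e) * (1 - x) <= thermal_value s x.
Proof.
move=> e0 hm.
have [nu00|nu0n] := eqVneq nu0 0.
  have m0 : m <= 0.
    apply: (@le_of_hbin_bound _ m 0 om) => x /[dup] x01 /andP[x0 x1].
    apply: (le_trans (hm x x01)); rewrite /thermal_value0 nu00 subr0 !lerD2r.
    by rewrite -mulrA mulr_ge0_le0// xlnx_le0// !ltW.
  (* This makes the loss 2 nu1 y at most [e / 2], whereas (m - e)(1 - x) <= - e / 2 because [m <= 0]
     and [x <= 2^-1]. *)
  pose y := Num.min 2^-1 (e / (4 * (nu1 + 1))).
  have y0 : 0 < y by rewrite lt_min invr_gt0 ltr0n divr_gt0// mulr_gt0// ltr_wpDl.
  have y1 : y <= 2^-1 by rewrite ge_min lexx.
  have yn : y * (4 * (nu1 + 1)) <= e.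
    by rewrite -ler_pdivlMr ?ge_min ?lexx ?orbT// mulr_gt0// ltr_wpDl.
  exists (y ^+ 2); first by rewrite exprn_gt0//=; nra.
  move=> s x /andP[s0 sd] /andP[x0 xy].
  have xy1 : x <= 2^-1 by nra.
  have h0 := @hbin_ge0 R x; rewrite x0 in h0.
  have {}h0 : 0 <= hbin x by apply: h0; lra.
  have s12 : s <= 2^-1 by nra.
  have sx : x `^ 2^-1 <= y.
    have -> : y = (y ^+ 2) `^ 2^-1.
      by rewrite -powR_mulrn ?ltW// -powRrM mulfV// powRr1// ltW.
    by rewrite ge0_ler_powR// ?nnegrE ?(ltW xy) ?invr_ge0 ?ler0n ?sqr_ge0.
  (* Young with weight [2 * s] between [x] and its square root, which is at most [y]. *)
  have key : x `^ (1 - s) - x <= s * (2 * y).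
    have := @wgm_young R (2 * s) x (x `^ 2^-1); rewrite powR_ge0 x0.
    have -> : wgm (2 * s) x (x `^ 2^-1) = x `^ (1 - s).
      rewrite /wgm -powRrM -powRD; first by congr (_ `^ _); field.
      by apply/implyP => /eqP h; exfalso; move: h s12; lra.
    have [|s12'] := ltP s 2^-1.
      move=> s12' /(_ _ isT isT); rewrite (_ : 0 < 2 * s < 1) => [/(_ isT)|]; first nra.
      by apply/andP; split; lra.
    have -> : s = 2^-1 by apply/le_anti; rewrite s12.
    move=> _; have -> : 1 - 2^-1 = 2^-1 :> R by field.
    by have := y0; lra.
  rewrite /thermal_value nu00 mul0r add0r.
  have : - (nu1 * (2 * y)) <= s^-1 * (nu1 * (x - x `^ (1 - s))).
    by rewrite ler_pdivlMl//; have := ler_wpM2l hnu1 key; lra.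
  have := mulr_ge0 hom x0.
  have : (m - e) * (1 - x) <= - e / 2 by nra.
  nra.
have nu0p : 0 < nu0 by rewrite lt_neqAle eq_sym nu0n.
(* Chosen so that [nu0 * (Y / 2)] exceeds |m| + nu1, which covers [m] and the possible loss [nu1] of
   the second term. *)
pose Y := 2 * (`|m| + nu1) / nu0 + 1.
have Y1 : 1 <= Y by rewrite /Y lerDr divr_ge0// mulr_ge0// addr_ge0.
have Y0 : 0 < Y by lra.
pose d := expR (- Y).
have d0 : 0 < d by exact: expR_gt0.
have d1 : d <= 2^-1.
  rewrite /d expRN lef_pV2 ?posrE ?expR_gt0//.
  by apply: le_trans (expR_ge1Dx Y); lra.
exists d; first by rewrite d0.
move=> s x /andP[s0 sd] /andP[x0 xd].
have x1 : x <= 2^-1 by lra.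
have h0 : 0 <= hbin x by apply: hbin_ge0; rewrite x0; lra.
have s1 : s < 1 by lra.
have Yd : Y * d <= 1.
  rewrite /d expRN ler_pdivrMr ?expR_gt0// mul1r.
  by apply: le_trans (expR_ge1Dx Y); lra.
have sY : s * Y <= 1 by nra.
have xs : x `^ s <= expR (- (s * Y)).
  have -> : expR (- (s * Y)) = d `^ s by rewrite /d -expRM; congr expR; ring.
  by rewrite ge0_ler_powR// ?nnegrE ?(ltW xd) ?(ltW s0)// ltW.
(* With v = s Y <= 1, 1 - expR (- v) >= v / (1 + v) >= v / 2. *)
have h1 : s * (Y / 2) <= 1 - x `^ s.
  have : expR (- (s * Y)) * (1 + s * Y) <= 1.
    rewrite expRN mulrC ler_pdivrMr ?expR_gt0// mul1r; exact: expR_ge1Dx.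
  have := expR_gt0 (- (s * Y)); have : 0 <= s * Y by nra.
  rewrite [s * (Y / 2)]mulrA.
  move: xs sY; move: (expR (- (s * Y))) (x `^ s) (s * Y) => E X v; nra.
have h2 : (1 - x) * - s <= x - x `^ (1 - s).
  have := @wgm_young R s x 1; rewrite /wgm powR1 mulr1 => /(_ _ x0 ler01).
  by rewrite s0 s1 => /(_ isT); lra.
have : nu0 * (Y / 2) - nu1 <= s^-1 * (nu0 * (1 - x `^ s) + nu1 * (x - x `^ (1 - s))).
  rewrite ler_pdivlMl//; have := ler_wpM2l hnu0 h1; have := ler_wpM2l hnu1 h2.
  have := mulr_ge0 hnu1 (mulr_ge0 (ltW s0) x0); nra.
have -> : nu0 * (Y / 2) = `|m| + nu1 + nu0 / 2 by rewrite /Y; field.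
have := mulr_ge0 hom x0; rewrite /thermal_value.
have : (m - e) * (1 - x) <= `|m|.
  have := ler_norm m; have := normr_ge0 m; nra.
lra.
Qed.

(** Exchange of [s -> 0] with the infimum over [x]: [thermal_value_near0] covers [x < d], and for
    [x >= d] a second-order Taylor error is controlled. *)
Lemma thermal_value_uniform m e : 0 < e ->
  (forall x, 0 < x < 1 -> m * (1 - x) <= thermal_value0 x) ->
  exists2 s, 0 < s < 1 & forall x, 0 <= x < 1 ->
    (m - e) * (1 - x) <= thermal_value s x.
Proof.
move=> e0 hm; have [d /andP[d0 d1] hd] := thermal_value_near0 e0 hm.
(* The Taylor error is at most [(nu0 + 2 * nu1) * s * L ^+ 2]; the summand 1 keeps [C] positive. *)
pose C := nu0 + 2 * nu1 + 1.
have C0 : 0 < C by rewrite ltr_wpDl// addr_ge0// mulr_ge0.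
pose s := Num.min (d / 2) (e * d ^+ 2 / C).
have s0 : 0 < s.
  by rewrite lt_min divr_gt0//= divr_gt0// mulr_gt0// exprn_gt0.
have sd : s <= d / 2 by rewrite ge_min lexx.
have sC : s * C <= e * d ^+ 2 by rewrite -ler_pdivlMr// ge_min lexx orbT.
exists s; first by rewrite s0/=; lra.
move=> x /andP[x0 x1]; have [xd|dx] := ltP x d.
  by apply: hd; rewrite ?s0 ?x0.
have xp : 0 < x by lra.
set L := - ln x.
have L0 : 0 <= L by rewrite oppr_ge0 ln_le0// ltW.
have Lx : L * x <= 1 - x.
  have := ler_wpM2r (ltW xp) (opp_ln_le xp); by rewrite mulrBl mulVf ?gt_eqF// mul1r.
have Ld : L * d <= 1 - x by have := ler_wpM2l L0 dx; lra.
have Ld0 : 0 <= L * d by rewrite mulr_ge0// ltW.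
(* Hence the error decays like [1 - x] as [x] tends to 1, as the factor [1 - x] in the claim
   demands. *)
have LL : L ^+ 2 * d ^+ 2 <= 1 - x.
  by rewrite -exprMn; move: Ld Ld0 xp; move: (L * d) => z; nra.
have sL : s * L <= 2^-1 by have := ler_wpM2r L0 sd; lra.
have h1 : s * L - (s * L) ^+ 2 <= 1 - x `^ s.
  have := @powR_le_taylor x s; rewrite xp (ltW x1) (ltW s0) => /(_ isT isT).
  have -> : s * ln x = - (s * L) by rewrite /L; ring.
  by rewrite sqrrN; lra.
have h2 : - (s * L) * x - 2 * (s * L) ^+ 2 <= x - x `^ (1 - s).
  have xn : x != 0 by rewrite gt_eqF.
  rewrite powRB ?xn ?implybT// powRr1 ?(ltW xp)// -powRN.
  have := @powRN_le_taylor x s; rewrite xp (ltW x1) (ltW s0) => /(_ isT isT).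
  have -> : s * ln x = - (s * L) by rewrite /L; ring.
  rewrite opprK sqrrN => /(_ sL) /(ler_wpM2l (ltW xp)).
  have : x * (2 * (s * L) ^+ 2) <= 2 * (s * L) ^+ 2.
    by rewrite ler_piMl ?(ltW x1)// mulr_ge0// sqr_ge0.
  lra.
have h3 : nu0 * (L - s * L ^+ 2) + nu1 * (- L * x - 2 * s * L ^+ 2) <=
   s^-1 * (nu0 * (1 - x `^ s) + nu1 * (x - x `^ (1 - s))).
  rewrite ler_pdivlMl//; have := ler_wpM2l hnu0 h1; have := ler_wpM2l hnu1 h2; lra.
have := hm x; rewrite xp x1 => /(_ isT); rewrite /thermal_value0 /thermal_value.
have -> : ln x = - L by rewrite /L opprK.
suff : (nu0 + 2 * nu1) * s * L ^+ 2 <= e * (1 - x) by move: h3; lra.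
have h4 : (nu0 + 2 * nu1) * s <= e * d ^+ 2.
  by apply: le_trans sC; rewrite /C; nra.
have := ler_wpM2r (sqr_ge0 L) h4.
have := ler_wpM2l (ltW e0) LL; lra.
Qed.

End thermal_function.

(** * Truncated spectra *)

Lemma cvg_sumr {R : realType} (I : Type) (r : seq I) (f : I -> nat -> R)
    (a : I -> R) : (forall i, f i @ \oo --> a i) ->
  (fun n => \sum_(i <- r) f i n) @ \oo --> \sum_(i <- r) a i.
Proof.
move=> fa; elim: r => [|i r ih].
  by under eq_fun do rewrite big_nil; rewrite big_nil; exact: cvg_cst.
by under eq_fun do rewrite big_cons; rewrite big_cons; exact: cvgD.
Qed.

(** * Minimum principle for the number operator *)

Section min_principle.
Context {R : realType}.
Variables (l : nat -> R) (K : nat).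
Hypothesis l_ge0 : forall k, 0 <= l k.
Hypothesis l_anti : forall i j, (i <= j)%N -> l j <= l i.
Hypothesis l_K : forall k, (K <= k)%N -> l k = 0.

(** The function sending [m] to [tail l K m.+1] is convex, and [- l j] is a subgradient at [j]. *)
Lemma tail_tangent j m : l j * j%:R + tail l K j.+1 <= l j * m%:R + tail l K m.+1.
Proof.
have step n : tail l K n.+1 = l n.+1 + tail l K n.+2 by exact: tail_recl.
have [jm|/ltnW mj] := leqP j m.
  rewrite -(subnKC jm); elim: (m - j)%N => [|n ih]; first by rewrite addn0.
  apply: le_trans ih _; rewrite addnS step -natr1.
  by have := @l_anti j (j + n).+1 (leq_trans (leq_addr _ _) (leqnSn _)); lra.
suff h n : (m + n <= j)%N ->
    l j * (m + n)%:R + tail l K (m + n).+1 <= l j * m%:R + tail l K m.+1.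
  by have := h (j - m)%N; rewrite subnKC// => ->.
elim: n => [|n ih]; first by rewrite addn0.
rewrite addnS => nj; apply: le_trans (ih (ltnW nj)).
rewrite (step (m + n)%N) -natr1.
by have := l_anti nj; lra.
Qed.

(* The dual certificate of the assignment problem behind the minimum
   principle for [a^dag a]: row sums of [P] are 1, column sums at most 1. *)
Lemma min_principle (P : nat -> nat -> R) (b : nat -> R) :
  (forall j m, (j < K)%N -> 0 <= P j m) ->
  (forall m, \sum_(j < K) P j m <= 1) ->
  (forall j, (j < K)%N -> series (P j) @ \oo --> (1 : R)) ->
  (forall j, (j < K)%N -> series (fun m => m%:R * P j m) @ \oo --> b j) ->
  \sum_(j < K) j%:R * l j <= \sum_(j < K) l j * b j.
Proof.
(* [be] prices the columns; [l j * j%:R + be j] prices the rows, and [tail_tangent] is dual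
   feasibility. *)
move=> P0 col row mom; pose be m := tail l K m.+1.
have be0 m : 0 <= be m by rewrite /be tail_ge0.
suff : \sum_(j < K) (l j * j%:R + be j) * 1 <=
       \sum_(j < K) l j * b j + \sum_(j < K) be j.
  under eq_bigr do rewrite mulr1 [l _ * _]mulrC.
  by rewrite big_split/= lerD2r.
have c1 : (fun Q => \sum_(j < K) (l j * j%:R + be j) * series (P j) Q) @ \oo
    --> \sum_(j < K) (l j * j%:R + be j) * 1.
  apply: (cvg_sumr (f := fun (j : 'I_K) Q => (l j * j%:R + be j) * series (P j) Q)).
  by move=> j; apply: cvgMl_tmp; exact: row.
have c2 : (fun Q => \sum_(j < K) l j * series (fun m => m%:R * P j m) Q
     + \sum_(j < K) be j) @ \oo --> \sum_(j < K) l j * b j + \sum_(j < K) be j.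
  apply: cvgD; last exact: cvg_cst.
  apply: (cvg_sumr (f := fun (j : 'I_K) Q => l j * series (fun m => m%:R * P j m) Q)).
  by move=> j; apply: cvgMl_tmp; exact: mom.
apply: (ler_cvg_to c1 c2); apply: nearW => Q.
(* [be] vanishes from index [K] on, so its partial sums never exceed this finite sum. *)
have beQ : \sum_(0 <= m < Q) be m <= \sum_(j < K) be j.
  rewrite -(big_mkord xpredT be).
  have beK m : (K <= m)%N -> be m = 0.
    by move=> Km; rewrite /be /tail big_geq// (leq_trans Km).
  have [QK|/ltnW KQ] := leqP Q K.
    by rewrite (big_cat_nat (n := Q) (p := K))//= lerDl sumr_ge0.
  rewrite (big_cat_nat (n := K) (p := Q))//= gerDl big_nat_cond big1//.
  by move=> i; rewrite andbT => /andP[/beK].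
apply: le_trans (lerD (lexx _) beQ).
have : \sum_(0 <= m < Q) be m * \sum_(j < K) P j m <= \sum_(0 <= m < Q) be m.
  by apply: ler_sum => m _; rewrite ler_piMr.
move=> /(lerD (lexx (\sum_(j < K) l j * series (fun m => m%:R * P j m) Q))).
apply: le_trans.
under [X in _ + X]eq_bigr do rewrite mulr_sumr.
rewrite exchange_big/= -big_split/=; apply: ler_sum => j _.
rewrite /series/= !mulr_sumr -big_split/=; apply: ler_sum => m _.
have := ler_wpM2r (P0 j m (ltn_ord j)) (tail_tangent j m).
by rewrite -/(be j) -/(be m); lra.
Qed.

End min_principle.

Section truncation.
Context {R : realType} (nu0 nu1 om s : R).
Hypotheses (hnu0 : 0 <= nu0) (hnu1 : 0 <= nu1) (hom : 0 <= om) (s01 : 0 < s < 1).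
Variables (lam : nat -> R) (M P : nat -> nat -> R) (b : nat -> R).
Hypothesis lam_ge0 : forall j, 0 <= lam j.

(* The sums over [j] are restricted to [0 < lam j]: an eigenvector of
   eigenvalue 0 need not lie in the domain of [a]. *)
Lemma truncated_bound m N :
  (forall x, 0 <= x < 1 -> m * (1 - x) <= thermal_value nu0 nu1 om s x) ->
  \sum_(j < N) lam j <= 1 ->
  (forall i j, 0 <= M i j) -> (forall i j, 0 <= P i j) ->
  (forall i, 0 < lam i -> \sum_(j < N | 0 < lam j) M i j <= b i + 1) ->
  (forall j, 0 < lam j -> \sum_(i < N | 0 < lam i) M i j <= b j) ->
  (forall n, \sum_(j < N | 0 < lam j) P j n <= 1) ->
  (forall j, 0 < lam j -> series (P j) @ \oo --> (1 : R)) ->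
  (forall j, 0 < lam j -> series (fun n => n%:R * P j n) @ \oo --> b j) ->
  m * \sum_(j < N) lam j <= s^-1 *
   (nu0 * (\sum_(i < N) lam i * (b i + 1)
           - \sum_(i < N) \sum_(j < N) wgm s (lam i) (lam j) * M i j)
  + nu1 * (\sum_(i < N) lam i * b i
           - \sum_(i < N) \sum_(j < N) wgm s (lam i) (lam j) * M j i))
  + om * \sum_(i < N) lam i * b i
  + \sum_(i < N) - (lam i * ln (lam i)).
Proof.
move=> hm lam1 M0 P0 Mout Min col row mom.
have /andP[s0 s1] := s01.
(* The indices of positive eigenvalues, in decreasing order of eigenvalue. *)
have [r [pr sr]] : exists r : seq nat,
    perm_eq r [seq j <- iota 0 N | 0 < lam j] /\
    sorted (fun i j => lam j <= lam i) r.
  exists (sort (fun i j => lam j <= lam i) [seq j <- iota 0 N | 0 < lam j]).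
  by rewrite perm_sort; split=> //; apply: sort_sorted => x y; exact: le_total.
pose K := size r; pose si k := nth 0%N r k.
(* Padding with 0 makes index [K] the sink. *)
pose l k := if (k < K)%N then lam (si k) else 0.
have rP j : (j \in r) = (0 < lam j) && (j < N)%N.
  by rewrite (perm_mem pr) mem_filter mem_iota.
have siP k : (k < K)%N -> 0 < lam (si k).
  by move=> kK; have := mem_nth 0%N kK; rewrite rP => /andP[].
have lE k : (k < K)%N -> l k = lam (si k) by rewrite /l => ->.
have sumP (F : nat -> R) : \sum_(j < N | 0 < lam j) F j = \sum_(k < K) F (si k).
  rewrite -(big_mkord (fun j => 0 < lam j) F) /index_iota subn0 -big_filter.
  by rewrite -(perm_big _ pr) (big_nth 0%N) big_mkord.
(* The summands of the claim vanish at eigenvalue 0, so every sum can be reindexed by the sorted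
   positive eigenvalues. *)
have sumE (F : nat -> R) : (forall j, lam j = 0 -> F j = 0) ->
    \sum_(j < N) F j = \sum_(k < K) F (si k).
  move=> F0; rewrite -sumP [RHS]big_mkcond/=; apply: eq_bigr => j _.
  case: ltgtP (lam_ge0 j) => // /esym/F0//.
have l_ge0 k : 0 <= l k by rewrite /l; case: ifP.
have l_K k : (K <= k)%N -> l k = 0 by rewrite /l ltnNge => ->.
have l_anti i j : (i <= j)%N -> l j <= l i.
  rewrite {1}/l; case: ltnP => // jK ij; rewrite lE ?(leq_ltn_trans ij)//.
  have tr : transitive (fun i j : nat => lam j <= lam i).
    by move=> y x z xy yz; exact: le_trans yz xy.
  have := @sorted_leq_nth _ _ tr (fun x => lexx _) 0%N r sr.
  by move=> h; apply: h => //; rewrite inE (leq_ltn_trans ij).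
have w0l x y : x = 0 -> wgm s x y = 0 by move=> ->; exact: wgm0l.
have w0r x y : y = 0 -> wgm s x y = 0 by move=> ->; exact: wgm0r.
have lamE : \sum_(j < N) lam j = \sum_(k < K) l k.
  by rewrite sumE//; apply: eq_bigr => k _; rewrite lE.
have b1E : \sum_(i < N) lam i * (b i + 1) = \sum_(k < K) l k * (b (si k) + 1).
  rewrite (sumE (fun i => lam i * (b i + 1))) => [|j ->]; last by rewrite mul0r.
  by apply: eq_bigr => k _; rewrite lE.
have b0E : \sum_(i < N) lam i * b i = \sum_(k < K) l k * b (si k).
  rewrite (sumE (fun i => lam i * b i)) => [|j ->]; last by rewrite mul0r.
  by apply: eq_bigr => k _; rewrite lE.
have entE : \sum_(i < N) - (lam i * ln (lam i)) = \sum_(k < K) - (l k * ln (l k)).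
  rewrite (sumE (fun i => - (lam i * ln (lam i)))) => [|j ->]; last by rewrite mul0r oppr0.
  by apply: eq_bigr => k _; rewrite lE.
have crossE (F : nat -> nat -> R) :
    \sum_(i < N) \sum_(j < N) wgm s (lam i) (lam j) * F i j =
    \sum_(i < K) \sum_(j < K) wgm s (l i) (l j) * F (si i) (si j).
  rewrite (sumE (fun i => \sum_(j < N) wgm s (lam i) (lam j) * F i j)); last first.
    by move=> i i0; rewrite big1// => j _; rewrite w0l// mul0r.
  apply: eq_bigr => i _.
  rewrite (sumE (fun j => wgm s (lam (si i)) (lam j) * F (si i) j)); last first.
    by move=> j j0; rewrite w0r// mul0r.
  by apply: eq_bigr => j _; rewrite !lE.
rewrite lamE b1E b0E entE (crossE M) (crossE (fun i j => M j i)).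
have fl := @flow_bound R nu0 nu1 s hnu0 hnu1 s01 l K l_ge0 l_anti l_K
  (fun i j => M (si i) (si j)) (b \o si).
have {}fl := fl (fun i j _ _ => M0 _ _).
have {}fl : \sum_(i < K) pot nu0 nu1 s l K i <= s^-1 *
    (nu0 * (\sum_(k < K) l k * (b (si k) + 1) -
            \sum_(i < K) \sum_(j < K) wgm s (l i) (l j) * M (si i) (si j)) +
     nu1 * (\sum_(k < K) l k * b (si k) -
            \sum_(i < K) \sum_(j < K) wgm s (l i) (l j) * M (si j) (si i))).
  apply: fl => k kK /=; first by rewrite -(sumP (M (si k))) Mout ?siP.
  by rewrite -(sumP (M ^~ (si k))) Min ?siP.
have mp : \sum_(j < K) j%:R * l j <= \sum_(k < K) l k * b (si k).
  apply: (@min_principle _ l K l_ge0 l_anti l_K (fun k => P (si k)) (b \o si)) => //.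
  - by move=> n; rewrite -(sumP (P ^~ n)).
  - by move=> j jK; apply: row; exact: siP.
  - by move=> j jK; apply: mom; exact: siP.
apply: le_trans (lerD (lerD fl (ler_wpM2l hom mp)) (lexx _)).
apply: chain_bound => //; last by rewrite -lamE.
by move=> k kK; rewrite lE// siP.
Qed.

End truncation.

(** * Fock space *)

Section series.
Context {R : realType}.
Implicit Types (u v : nat -> R) (f : nat -> \bar R).

Lemma cvg_nneseries u : (forall n, 0 <= u n) ->
  (\sum_(n <oo) (u n)%:E < +oo)%E ->
  series u @ \oo --> fine (\sum_(n <oo) (u n)%:E)%E.
Proof.
move=> u0 ufin.
have -> : series u = fine \o (fun n => \sum_(0 <= k < n) (u k)%:E)%E.
  by apply/funext => n; rewrite /series/= sumEFin.
apply: fine_cvg; rewrite fineK; last first.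
  by rewrite ge0_fin_numE// nneseries_ge0// => n _ _; rewrite lee_fin.
by apply: is_cvg_nneseries => n _ _; rewrite lee_fin.
Qed.

Lemma nneseries_lim u l : series u @ \oo --> l ->
  (\sum_(n <oo) (u n)%:E)%E = l%:E.
Proof.
move=> ul; apply/cvg_lim => //.
have -> : (fun n => \sum_(0 <= k < n) (u k)%:E)%E = EFin \o series u.
  by apply/funext => n; rewrite /series/= sumEFin.
by apply: cvg_EFin; [apply: nearW => n | exact: ul].
Qed.

Lemma nneseries_fine u : (forall n, 0 <= u n) ->
  (\sum_(n <oo) (u n)%:E < +oo)%E ->
  (\sum_(n <oo) (u n)%:E)%E = (fine (\sum_(n <oo) (u n)%:E)%E)%:E.
Proof. by move=> u0 ufin; apply: nneseries_lim; exact: cvg_nneseries. Qed.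

Lemma nneseriesS f : (forall n, 0 <= f n)%E ->
  (\sum_(n <oo) f n = f 0%N + \sum_(n <oo) f n.+1)%E.
Proof.
move=> f0; rewrite nneseries_recl// -(nneseries_addn 1)//.
by congr (_ + _)%E; apply: eq_eseriesr => n _; rewrite addn1.
Qed.

Lemma series_single u m : (forall n, n != m -> u n = 0) ->
  series u @ \oo --> u m.
Proof.
move=> u0; apply: cvg_near_cst; near=> Q; rewrite /series/=.
have mQ : (m < Q)%N by near: Q; exists m.+1.
rewrite big_mkord (bigD1 (Ordinal mQ))//= big1 ?addr0// => i im.
by rewrite u0.
Unshelve. all: by end_near. Qed.

Lemma limn_series_single u m : (forall n, n != m -> u n = 0) ->
  limn (series u) = u m.
Proof. by move=> /series_single/cvg_lim; apply. Qed.

End series.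

Section ket_space.
Context {R : realType}.
Implicit Types (phi chi : ket R) (z w : R[i]).

Lemma sqmod_ge0 z : 0 <= sqmod z.
Proof. by rewrite addr_ge0 ?sqr_ge0. Qed.

Lemma sqmodM z w : sqmod (z * w) = sqmod z * sqmod w.
Proof. by case: z w => a b [c d]; rewrite /sqmod/=; ring. Qed.

Lemma sqmod_conj z : sqmod (conjc z) = sqmod z.
Proof. by case: z => a b; rewrite /sqmod/= sqrrN. Qed.

Lemma sqmod_real x : sqmod (real_complex R x) = x ^+ 2.
Proof. by rewrite /sqmod/= expr0n addr0. Qed.

Lemma sqmod_nat (b : bool) : sqmod (b%:R : R[i]) = b%:R.
Proof. by case: b; rewrite /sqmod/= ?expr1n ?expr0n/= ?addr0. Qed.

Lemma ReM z w :
  complex.Re (z * w) = complex.Re z * complex.Re w - complex.Im z * complex.Im w.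
Proof. by case: z w => a b [c d]. Qed.

Lemma Re_sum (I : Type) (r : seq I) (F : I -> R[i]) :
  complex.Re (\sum_(i <- r) F i) = \sum_(i <- r) complex.Re (F i).
Proof. by apply: (big_morph (@complex.Re R)) => // -[a b] [c d]. Qed.

Lemma Im_sum (I : Type) (r : seq I) (F : I -> R[i]) :
  complex.Im (\sum_(i <- r) F i) = \sum_(i <- r) complex.Im (F i).
Proof. by apply: (big_morph (@complex.Im R)) => // -[a b] [c d]. Qed.

(** The last term stays a real part so that, in [bessel], it expands into a double sum of inner
    products. *)
Lemma sqmodB z w :
  sqmod (z - w) = sqmod z - 2 * complex.Re (conjc w * z) + complex.Re (conjc w * w).
Proof. by case: z w => a b [c d]; rewrite /sqmod/=; ring. Qed.

Lemma sqnorm_ge0 phi : (0 <= sqnorm phi)%E.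
Proof. by apply: nneseries_ge0 => n _ _; rewrite lee_fin sqmod_ge0. Qed.

Lemma sqnormE phi : in_l2 phi -> sqnorm phi = (fine (sqnorm phi))%:E.
Proof. by move=> h; apply: nneseries_fine => // n; exact: sqmod_ge0. Qed.

Lemma sqnorm_cvg phi : in_l2 phi ->
  series (fun n => sqmod (phi n)) @ \oo --> fine (sqnorm phi).
Proof. by move=> h; apply: cvg_nneseries => // n; exact: sqmod_ge0. Qed.

(** Domination by the two norm series; [g] is the real or the imaginary part of conjc z w. *)
Lemma series_mul_cvg (g : R[i] -> R[i] -> R) phi chi :
  (forall z w, `|g z w| <= sqmod z + sqmod w) -> in_l2 phi -> in_l2 chi ->
  cvgn (series (fun n => g (phi n) (chi n))).
Proof.
move=> gle hphi hchi; apply: normed_cvg.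
apply: (@series_le_cvg _ _ (fun n => sqmod (phi n) + sqmod (chi n))) => //=.
- by move=> n; rewrite addr_ge0 ?sqmod_ge0.
have -> : series (fun n => sqmod (phi n) + sqmod (chi n)) =
   series (fun n => sqmod (phi n)) \+ series (fun n => sqmod (chi n)).
  by apply/funext => n; rewrite /series/= big_split.
apply: cvgP; apply: cvgD; [exact: sqnorm_cvg hphi|exact: sqnorm_cvg hchi].
Qed.

Lemma inner_Re_cvg phi chi : in_l2 phi -> in_l2 chi ->
  series (fun n => complex.Re (conjc (phi n) * chi n)) @ \oo
    --> complex.Re (inner phi chi).
Proof.
move=> hphi hchi.
apply: (@series_mul_cvg (fun z w => complex.Re (conjc z * w))) => // -[a b] [c d].
rewrite /sqmod/= ler_norml.
have := (sqr_ge0 (a + c), sqr_ge0 (a - c), sqr_ge0 (b + d), sqr_ge0 (b - d)).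
by move=> [[[h1 h2] h3] h4]; apply/andP; split; nra.
Qed.

Lemma inner_Im_cvg phi chi : in_l2 phi -> in_l2 chi ->
  series (fun n => complex.Im (conjc (phi n) * chi n)) @ \oo
    --> complex.Im (inner phi chi).
Proof.
move=> hphi hchi.
apply: (@series_mul_cvg (fun z w => complex.Im (conjc z * w))) => // -[a b] [c d].
rewrite /sqmod/= ler_norml.
have := (sqr_ge0 (a + d), sqr_ge0 (a - d), sqr_ge0 (b + c), sqr_ge0 (b - c)).
by move=> [[[h1 h2] h3] h4]; apply/andP; split; nra.
Qed.

Lemma orthonormal_sqnorm (psi : nat -> ket R) j : orthonormal_family psi ->
  series (fun n => sqmod (psi j n)) @ \oo --> (1 : R).
Proof.
move=> [psi2 psi1].
have -> : 1 = complex.Re (inner (psi j) (psi j)) :> R by rewrite psi1 eqxx.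
have := inner_Re_cvg (psi2 j) (psi2 j).
suff -> : (fun n => complex.Re (conjc (psi j n) * psi j n))
  = (fun n => sqmod (psi j n)) by [].
by apply/funext => n; case: (psi j n) => a b; rewrite /sqmod/=; ring.
Qed.

(** The residual of [phi] has nonnegative squared norm. The expansion is made on the first [Q] Fock
    coordinates, where all sums are finite, and [Q] is then sent to infinity. *)
Lemma bessel (psi : nat -> ket R) phi N : orthonormal_family psi -> in_l2 phi ->
  \sum_(i < N) sqmod (inner (psi i) phi) <= fine (sqnorm phi).
Proof.
move=> [psi2 psi1] phi2; pose c i := inner (psi i) phi.
pose pin (f g : ket R) Q := \sum_(0 <= n < Q) conjc (f n) * g n.
pose res n := phi n - \sum_(i < N) c i * psi i n.
have resE Q : series (fun n => sqmod (res n)) Q =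
    series (fun n => sqmod (phi n)) Q
    - 2 * \sum_(i < N) complex.Re (conjc (c i) * pin (psi i) phi Q)
    + \sum_(i < N) \sum_(j < N)
        complex.Re (conjc (c i) * c j * pin (psi i) (psi j) Q).
  rewrite /series/= (eq_bigr _ (fun n _ => sqmodB _ _)) big_split/= sumrB.
  rewrite -mulr_sumr -!Re_sum; congr (_ - 2 * complex.Re _ + _).
    under eq_bigr do rewrite rmorph_sum/= mulr_suml.
    rewrite exchange_big/=; apply: eq_bigr => i _.
    rewrite /pin mulr_sumr; apply: eq_bigr => n _.
    by rewrite rmorphM mulrA.
  under [RHS]eq_bigr do rewrite -Re_sum.
  rewrite -Re_sum; congr (complex.Re _).
  under eq_bigr do rewrite rmorph_sum/= mulr_suml.
  rewrite exchange_big/=; apply: eq_bigr => i _.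
  under eq_bigr do rewrite mulr_sumr.
  rewrite exchange_big/=; apply: eq_bigr => j _.
  rewrite /pin mulr_sumr; apply: eq_bigr => n _.
  by rewrite rmorphM mulrACA.
have pinR f g : in_l2 f -> in_l2 g ->
    (fun Q => complex.Re (pin f g Q)) @ \oo --> complex.Re (inner f g).
  move=> hf hg; under eq_fun do rewrite /pin Re_sum.
  exact: inner_Re_cvg.
have pinI f g : in_l2 f -> in_l2 g ->
    (fun Q => complex.Im (pin f g Q)) @ \oo --> complex.Im (inner f g).
  move=> hf hg; under eq_fun do rewrite /pin Im_sum.
  exact: inner_Im_cvg.
have pinM a f g : in_l2 f -> in_l2 g ->
    (fun Q => complex.Re (a * pin f g Q)) @ \oo --> complex.Re (a * inner f g).
  move=> hf hg; rewrite ReM; under eq_fun do rewrite ReM.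
  by apply: cvgB; apply: cvgMl_tmp; [exact: pinR|exact: pinI].
have lim : series (fun n => sqmod (res n)) @ \oo --> fine (sqnorm phi)
    - 2 * \sum_(i < N) complex.Re (conjc (c i) * c i)
    + \sum_(i < N) \sum_(j < N)
        complex.Re (conjc (c i) * c j * inner (psi i) (psi j)).
  rewrite (funext resE).
  apply: cvgD; first apply: cvgB; first exact: sqnorm_cvg.
    apply: cvgMl_tmp.
    apply: (cvg_sumr (f := fun (i : 'I_N) Q => complex.Re (conjc (c i) * pin (psi i) phi Q))).
    by move=> i; exact: pinM.
  apply: (cvg_sumr (f := fun (i : 'I_N) Q => \sum_(j < N)
        complex.Re (conjc (c i) * c j * pin (psi i) (psi j) Q))) => i.
  apply: (cvg_sumr (f := fun (j : 'I_N) Q =>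
        complex.Re (conjc (c i) * c j * pin (psi i) (psi j) Q))) => j.
  exact: pinM.
have /limr_ge : cvgn (series (fun n => sqmod (res n))) by apply: cvgP; exact: lim.
move=> /(_ 0); rewrite (cvg_lim _ lim)// => ge0.
have {ge0} : 0 <= fine (sqnorm phi)
    - 2 * \sum_(i < N) complex.Re (conjc (c i) * c i)
    + \sum_(i < N) \sum_(j < N)
        complex.Re (conjc (c i) * c j * inner (psi i) (psi j)).
  by apply: ge0; apply: nearW => Q; rewrite /series/= sumr_ge0// => n _; exact: sqmod_ge0.
have -> : \sum_(i < N) \sum_(j < N)
        complex.Re (conjc (c i) * c j * inner (psi i) (psi j))
    = \sum_(i < N) complex.Re (conjc (c i) * c i).
  apply: eq_bigr => i _; rewrite (bigD1 i)// {1}psi1 eqxx mulr1.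
  rewrite big1 => [|j /andP[_ ji]]; first exact: addr0.
  have -> : inner (psi i) (psi j) = 0.
    by rewrite psi1 eq_sym (inj_eq val_inj) (negbTE ji).
  by rewrite mulr0.
have -> : \sum_(i < N) complex.Re (conjc (c i) * c i) = \sum_(i < N) sqmod (c i).
  by apply: eq_bigr => i _; case: (c i) => a b; rewrite /sqmod/=; ring.
by rewrite /c; lra.
Qed.

Lemma sqmod_annih phi n : sqmod (annih phi n) = n.+1%:R * sqmod (phi n.+1).
Proof. by rewrite sqmodM sqmod_real sqr_sqrtr. Qed.

Lemma sqmod_creat phi n : sqmod (creat phi n) = n%:R * sqmod (phi n.-1).
Proof. by rewrite sqmodM sqmod_real sqr_sqrtr. Qed.

Lemma sqnorm_annih phi :
  sqnorm (annih phi) = (\sum_(n <oo) (n%:R * sqmod (phi n))%:E)%E.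
Proof.
rewrite [RHS]nneseriesS => [|n]; last by rewrite lee_fin mulr_ge0 ?sqmod_ge0.
by rewrite mul0r add0e; apply: eq_eseriesr => n _; rewrite sqmod_annih.
Qed.

(** The commutation relation of [a] and a^dag in norm form; infinite values are allowed. *)
Lemma sqnorm_creat phi : sqnorm (creat phi) = (sqnorm (annih phi) + sqnorm phi)%E.
Proof.
rewrite sqnorm_annih {1}/sqnorm nneseriesS => [|n]; last by rewrite lee_fin sqmod_ge0.
rewrite sqmod_creat mul0r add0e -nneseriesD; last 2 first.
- by move=> n _ _; rewrite lee_fin mulr_ge0 ?sqmod_ge0.
- by move=> n _ _; rewrite lee_fin sqmod_ge0.
by apply: eq_eseriesr => n _; rewrite sqmod_creat -EFinD -natr1 mulrDl mul1r.
Qed.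

(** The two inner products are complex conjugates: their series differ by an index shift, and
    coefficient 0 of [creat phi] is 0. *)
Lemma sqmod_adjoint phi chi : in_l2 phi -> in_l2 chi ->
  in_l2 (creat phi) -> in_l2 (annih chi) ->
  sqmod (inner phi (annih chi)) = sqmod (inner chi (creat phi)).
Proof.
move=> h1 h2 h3 h4.
have e n : conjc (phi n) * annih chi n
    = conjc (conjc (chi n.+1) * creat phi n.+1).
  rewrite /creat /annih [n.+1.-1]/=.
  move: (phi n) (chi n.+1) (Num.sqrt _) => [a b] [c d] x.
  by apply/eqP; rewrite eq_complex/=; apply/andP; split; apply/eqP; ring.
have e0 : conjc (chi 0%N) * creat phi 0%N = 0.
  by rewrite /creat sqrtr0 (_ : real_complex R 0 = 0)// mul0r mulr0.
have shift (u v : nat -> R) (a b : R) : series u @ \oo --> a -> series v @ \oo --> b ->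
    u 0%N = 0 -> (forall n, v n = u n.+1) -> a = b.
  move=> ua vb u0 vu; suff va : series v @ \oo --> a.
    by rewrite -(cvg_lim _ va)// (cvg_lim _ vb).
  have -> : series v = (fun n => series u n.+1).
    apply/funext => n; rewrite /series/= big_nat_recl// u0 add0r.
    by apply: eq_bigr => k _; rewrite vu.
  by rewrite (cvg_shiftS (series u)).
have eR := shift _ _ _ _ (inner_Re_cvg h2 h3) (inner_Re_cvg h1 h4).
rewrite /sqmod -eR; last 2 first.
- by rewrite e0.
- by move=> n; rewrite e; case: (_ * _).
have nI : series (fun n => complex.Im (conjc (chi n.+1) * creat phi n.+1)) @ \oo
    --> - complex.Im (inner phi (annih chi)).
  have -> : series (fun n => complex.Im (conjc (chi n.+1) * creat phi n.+1))
      = (fun Q => - series (fun n => complex.Im (conjc (phi n) * annih chi n)) Q).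
    apply/funext => Q; rewrite /series/= -sumrN; apply: eq_bigr => n _.
    by rewrite e; case: (_ * _) => a b /=; rewrite opprK.
  by apply: cvgN; exact: inner_Im_cvg.
have -> : complex.Im (inner chi (creat phi)) = - complex.Im (inner phi (annih chi)).
  by apply: shift (inner_Im_cvg h2 h3) nI _ _ => //; rewrite e0.
by rewrite sqrrN.
Qed.

Lemma sqnorm_fock m : series (fun n => sqmod (@fock R m n)) @ \oo --> (1 : R).
Proof.
have := @series_single R (fun n => sqmod (@fock R m n)) m.
rewrite /fock sqmod_nat eqxx; apply => n /negbTE nm.
by rewrite nm sqmod_nat.
Qed.

Lemma in_l2_fock m : in_l2 (@fock R m).
Proof. by rewrite /in_l2 /sqnorm (nneseries_lim (sqnorm_fock m)) ltry. Qed.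

Lemma inner_fockl m phi : inner (fock R m) phi = phi m.
Proof.
rewrite /inner /cseries.
rewrite !(@limn_series_single _ _ m); first by rewrite /fock eqxx conjc1 mul1r; case: (phi m).
- by move=> n /negbTE nm; rewrite /fock nm conjc0 mul0r.
- by move=> n /negbTE nm; rewrite /fock nm conjc0 mul0r.
Qed.

Lemma inner_fockr m phi : inner phi (fock R m) = conjc (phi m).
Proof.
rewrite /inner /cseries.
rewrite !(@limn_series_single _ _ m); first by rewrite /fock eqxx mulr1; case: (phi m).
- by move=> n /negbTE nm; rewrite /fock nm mulr0.
- by move=> n /negbTE nm; rewrite /fock nm mulr0.
Qed.

Lemma orthonormal_fock : orthonormal_family (@fock R).
Proof.
by split=> [j|i j]; [exact: in_l2_fock|rewrite inner_fockl].
Qed.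

End ket_space.

(** * Spectral decompositions *)

Section spectral.
Context {R : realType}.
Variables (rho : ket R -> ket R) (lam : nat -> R) (psi : nat -> ket R).
Hypothesis hdec : eigen_decomposition rho lam psi.

Let orth : orthonormal_family psi. Proof. by case: hdec. Qed.

Let psi2 j : in_l2 (psi j). Proof. by case: hdec => -[]. Qed.
Let psi1 i j : inner (psi i) (psi j) = (i == j)%:R.
Proof. by case: hdec => -[]. Qed.

Lemma sqmod_le_sqnorm (phi : ket R) m : ((sqmod (phi m))%:E <= sqnorm phi)%E.
Proof.
apply: le_trans (nneseries_lim_ge m.+1 _) => [|n _ _]; last by rewrite lee_fin sqmod_ge0.
rewrite big_nat_recr//= leeDr// sume_ge0// => n _.
by rewrite lee_fin sqmod_ge0.
Qed.

Lemma sqnorm_eq0 (phi : ket R) m : (sqnorm phi <= 0)%E -> phi m = 0.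
Proof.
move=> /(le_trans (sqmod_le_sqnorm phi m)); rewrite lee_fin /sqmod.
case: (phi m) => a b /= h; have := (sqr_ge0 a, sqr_ge0 b) => -[a0 b0].
have /eqP : a ^+ 2 = 0 by lra.
have /eqP : b ^+ 2 = 0 by lra.
by rewrite !sqrf_eq0 => /eqP -> /eqP ->.
Qed.

(** On [psi j] the partial sums of the decomposition are constant once [N > j], so their residual,
    which tends to 0, is 0. *)
Lemma eigen_ket j : rho (psi j) = (fun m => real_complex R (lam j) * psi j m).
Proof.
apply/funext => m; apply/eqP; rewrite -subr_eq0; apply/eqP.
apply: (@sqnorm_eq0 (fun m => rho (psi j) m - real_complex R (lam j) * psi j m)).
have [_ /(_ _ (psi2 j)) lim0] := hdec.
rewrite le_eqVlt; apply/orP; left; apply/eqP.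
rewrite -(cvg_lim _ lim0)//; apply/esym/lim_near_cst => //; near=> N.
have jN : (j < N)%N by near: N; exists j.+1.
congr (sqnorm _); apply/funext => k; congr (_ - _).
rewrite (bigD1 (Ordinal jN))//= psi1 eqxx mulr1 big1 ?addr0// => i ij.
have -> : inner (psi i) (psi j) = 0.
  by rewrite psi1; move: ij; rewrite -(inj_eq val_inj)/= => /negbTE ->.
by rewrite mulr0 mul0r.
Unshelve. all: by end_near. Qed.

Lemma eigenvalue_ge0 j : positive_semidefinite rho -> 0 <= lam j.
Proof.
move=> /(_ _ (psi2 j)); rewrite lecE => /andP[_]; rewrite /inner /cseries/=.
suff lim1 : series (fun n => complex.Re (conjc (psi j n) * rho (psi j) n)) @ \oo
    --> lam j * 1 by rewrite (cvg_lim _ lim1)// mulr1.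
have -> : series (fun n => complex.Re (conjc (psi j n) * rho (psi j) n))
    = (fun Q => lam j * series (fun n => sqmod (psi j n)) Q).
  apply/funext => Q; rewrite /series/= mulr_sumr; apply: eq_bigr => n _.
  by rewrite eigen_ket; case: (psi j n) => a b; rewrite /sqmod/=; ring.
by apply: cvgMl_tmp; exact: orthonormal_sqnorm orth.
Qed.

(** A coordinate is bounded by the norm, so norm convergence at [fock R n] gives convergence of its
    coordinate [n]. *)
Lemma diagonal_entry n :
  series (fun j => lam j * sqmod (psi j n)) @ \oo
    --> complex.Re (rho (fock R n) n).
Proof.
have [_ /(_ _ (in_l2_fock n)) lim0] := hdec.
set D := fun N => _ in lim0.
have e N : series (fun j => lam j * sqmod (psi j n)) N =
    complex.Re (rho (fock R n) n) - complex.Re (rho (fock R n) n -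
     \sum_(j < N) real_complex R (lam j) * inner (psi j) (fock R n) * psi j n).
  rewrite [complex.Re (_ - _)](_ : _ = complex.Re (rho (fock R n) n)
    - complex.Re (\sum_(j < N) real_complex R (lam j) * inner (psi j) (fock R n) * psi j n)).
    rewrite opprB addrCA subrr addr0 Re_sum /series/= big_mkord; apply: eq_bigr => j _.
    by rewrite inner_fockr; case: (psi j n) => a b; rewrite /sqmod/=; ring.
  by case: (rho _ _) (\sum_(j < N) _) => a b [c d].
rewrite (funext e) -[X in _ --> X]subr0; apply: cvgB; first exact: cvg_cst.
apply/cvgr0Pnorm_lt => eps eps0.
have : (0 < (eps ^+ 2)%:E)%E by rewrite lte_fin exprn_gt0.
move=> /open_ereal_lt'/lim0 small; near=> N.
have : (D N < (eps ^+ 2)%:E)%E by near: N; exact: small.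
rewrite /D => /(le_lt_trans (sqmod_le_sqnorm _ n)); rewrite lte_fin /sqmod => h.
rewrite -(ltr_pXn2r (n := 2))// ?nnegrE// ?(ltW eps0)// real_normK ?num_real//.
by apply: le_lt_trans h; rewrite lerDl sqr_ge0.
Unshelve. all: by end_near. Qed.

(** The diagonal entries are summed first over the Fock index by Tonelli, and each [psi j] has norm
    1. *)
Lemma eigenvalue_sum : (forall j, 0 <= lam j) -> trace rho = 1%E ->
  (\sum_(j <oo) (lam j)%:E = 1)%E.
Proof.
move=> lam0 <-; rewrite /trace.
have diagE n : (complex.Re (inner (fock R n) (rho (fock R n))))%:E
    = (\sum_(j <oo) (lam j * sqmod (psi j n))%:E)%E.
  by rewrite inner_fockl; apply/esym/nneseries_lim; exact: diagonal_entry.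
under [RHS]eq_eseriesr do rewrite diagE.
rewrite nneseries_interchange; last by move=> i j; rewrite lee_fin mulr_ge0 ?sqmod_ge0.
apply: eq_eseriesr => j _.
suff lim1 : series (fun n => lam j * sqmod (psi j n)) @ \oo --> lam j * 1.
  by rewrite (nneseries_lim lim1) mulr1.
have -> : series (fun n => lam j * sqmod (psi j n))
    = (fun Q => lam j * series (fun n => sqmod (psi j n)) Q).
  by apply/funext => Q; rewrite /series/= mulr_sumr.
by apply: cvgMl_tmp; exact: orthonormal_sqnorm orth.
Qed.

End spectral.

(** * Double series as limits of square partial sums *)

Section double_series.
Context {R : realType}.
Implicit Types f : nat -> nat -> R.

(** Square sums increase, and the rectangle with sides [I], [J] lies in the square of side
    [maxn I J]. *)
Lemma double_series_cvg f : (forall i j, 0 <= f i j) ->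
  ((\sum_(i < N) \sum_(j < N) f i j)%:E @[N --> \oo]
     --> \sum_(i <oo) \sum_(j <oo) (f i j)%:E)%E.
Proof.
move=> f0; set S := (X in _ --> X).
have f0' i j : (0 <= (f i j)%:E)%E by rewrite lee_fin.
have row0 i : (0 <= \sum_(j <oo) (f i j)%:E)%E by exact: nneseries_ge0.
pose a N := (\sum_(i < N) \sum_(j < N) f i j)%:E.
have aE N : a N = (\sum_(0 <= i < N) \sum_(0 <= j < N) (f i j)%:E)%E.
  by rewrite /a big_mkord -sumEFin; apply: eq_bigr => i _; rewrite big_mkord sumEFin.
have mono N N' : (N <= N')%N -> (a N <= a N')%E.
  move=> NN; rewrite !aE [leRHS](big_cat_nat (n := N))//= -[leLHS]adde0.
  apply: leeD; last by apply: sume_ge0 => i _; apply: sume_ge0.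
  apply: lee_sum => i _; rewrite [leRHS](big_cat_nat (n := N))//= leeDl//.
  exact: sume_ge0.
have ac : a @ \oo --> limn a by apply: ereal_nondecreasing_is_cvgn => N N'; exact: mono.
have aL N : (a N <= limn a)%E.
  rewrite (cvg_lim _ (ereal_nondecreasing_cvgn mono))//.
  by apply: ereal_sup_ubound; exists N.
suff -> : S = limn a by exact: ac.
apply/eqP; rewrite eq_le; apply/andP; split; last first.
  apply: lime_le; first by apply: cvgP; exact: ac.
  apply: nearW => N; rewrite aE; apply: le_trans (nneseries_lim_ge N _) => //.
  by apply: lee_sum => i _; exact: nneseries_lim_ge.
apply: lime_le; first exact: is_cvg_nneseries.
apply: nearW => I; rewrite -nneseries_sum_nat//.
apply: lime_le; first by apply: is_cvg_nneseries => j _ _; exact: sume_ge0.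
apply: nearW => J; rewrite exchange_big/=.
apply: le_trans (aL (maxn I J)); rewrite aE.
rewrite [leRHS](big_cat_nat (n := I))//= ?leq_maxl// -[leLHS]adde0.
apply: leeD; last by apply: sume_ge0 => i _; apply: sume_ge0.
apply: lee_sum => i _; rewrite [leRHS](big_cat_nat (n := J))//= ?leq_maxr// leeDl//.
exact: sume_ge0.
Qed.

End double_series.

(** * The functional *)

Section cross_sums.
Context {R : realType}.
Variables (lam : nat -> R) (F : nat -> nat -> R) (c c' : nat -> R) (X X' : R).
Hypothesis lam_ge0 : forall j, 0 <= lam j.
Hypothesis F_ge0 : forall i j, 0 <= F i j.
Hypothesis row : forall N i, 0 < lam i -> \sum_(j < N | 0 < lam j) F i j <= c i.
Hypothesis col : forall N j, 0 < lam j -> \sum_(i < N | 0 < lam i) F i j <= c' j.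
Hypothesis cX : forall N, \sum_(i < N) lam i * c i <= X.
Hypothesis cX' : forall N, \sum_(j < N) lam j * c' j <= X'.

(** With [F] the matrix of overlaps or its transpose and [s = 1 - 1/p], this covers both
    [cross_annih] and [cross_creat]. *)
Definition cross s : \bar R :=
  (\sum_(i <oo) \sum_(j <oo) (wgm s (lam i) (lam j) * F i j)%:E)%E.

Let lam_eq0 j : ~~ (0 < lam j) -> lam j = 0.
Proof. by move=> h; apply/eqP; rewrite eq_le lam_ge0 andbT leNgt. Qed.

Let big_pos (G : nat -> R) N : (forall j, lam j = 0 -> G j = 0) ->
  \sum_(j < N) G j = \sum_(j < N | 0 < lam j) G j.
Proof.
move=> G0; rewrite [RHS]big_mkcond/=; apply: eq_bigr => j _.
by case: ifPn => // /lam_eq0/G0.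
Qed.

Let crossN_pos s N : 0 < s < 1 ->
  \sum_(i < N) \sum_(j < N) wgm s (lam i) (lam j) * F i j =
  \sum_(i < N | 0 < lam i) \sum_(j < N | 0 < lam j) wgm s (lam i) (lam j) * F i j.
Proof.
move=> /andP[s0 s1].
rewrite (big_pos (G := fun i => \sum_(j < N) wgm s (lam i) (lam j) * F i j)); last first.
  by move=> i i0; rewrite big1// => j _; rewrite i0 wgm0l// mul0r.
apply: eq_bigr => i _.
rewrite (big_pos (G := fun j => wgm s (lam i) (lam j) * F i j))// => j j0.
by rewrite j0 wgm0r// mul0r.
Qed.

Let row_sum N :
  \sum_(i < N | 0 < lam i) \sum_(j < N | 0 < lam j) lam i * F i j <= X.
Proof.
apply: le_trans (cX N).
rewrite (big_pos (G := fun i => lam i * c i)); last by move=> i ->; rewrite mul0r.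
by apply: ler_sum => i i0; rewrite -mulr_sumr ler_wpM2l// row.
Qed.

Let col_sum N :
  \sum_(i < N | 0 < lam i) \sum_(j < N | 0 < lam j) lam j * F i j <= X'.
Proof.
apply: le_trans (cX' N); rewrite exchange_big/=.
rewrite (big_pos (G := fun i => lam i * c' i)); last by move=> i ->; rewrite mul0r.
by apply: ler_sum => i i0; rewrite -mulr_sumr ler_wpM2l// col.
Qed.

(** Young splits the weight between row sums and column sums; the bound is uniform in [N], whence
    finiteness of [cross]. *)
Lemma crossN_le s N : 0 < s < 1 ->
  \sum_(i < N) \sum_(j < N) wgm s (lam i) (lam j) * F i j <= (1 - s) * X + s * X'.
Proof.
move=> /[dup] s01 /andP[s0 s1]; rewrite crossN_pos//.
have t0 : 0 <= 1 - s by rewrite subr_ge0 ltW.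
apply: le_trans (lerD (ler_wpM2l t0 (row_sum N)) (ler_wpM2l (ltW s0) (col_sum N))).
rewrite !mulr_sumr -big_split/=; apply: ler_sum => i _.
rewrite !mulr_sumr -big_split/=; apply: ler_sum => j _.
have := ler_wpM2r (F_ge0 i j) (wgm_young s01 (lam_ge0 i) (lam_ge0 j)).
by rewrite mulrDl !mulrA.
Qed.

Let term_ge0 s i j : 0 <= wgm s (lam i) (lam j) * F i j.
Proof. by rewrite mulr_ge0 ?wgm_ge0. Qed.

Lemma cross_fin s : 0 < s < 1 -> cross s = (fine (cross s))%:E.
Proof.
move=> s01; have cvg := double_series_cvg (term_ge0 s).
rewrite fineK// ge0_fin_numE; last first.
  by apply: nneseries_ge0 => i _ _; apply: nneseries_ge0 => j _ _; rewrite lee_fin.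
apply: (@le_lt_trans _ _ ((1 - s) * X + s * X')%:E); last exact: ltry.
rewrite /cross -(cvg_lim _ cvg)//; apply: lime_le; first by apply: cvgP; exact: cvg.
by apply: nearW => N; rewrite lee_fin crossN_le.
Qed.

Lemma cross_cvg s : 0 < s < 1 ->
  (fun N => \sum_(i < N) \sum_(j < N) wgm s (lam i) (lam j) * F i j) @ \oo
    --> fine (cross s).
Proof.
move=> s01; have := double_series_cvg (term_ge0 s).
by rewrite -/(cross s) cross_fin// => /fine_cvg.
Qed.

(** By [wgm_wgm], the mean at [s] is the mean, with weight [s / s'], of [lam i] and the mean at
    [s']. Young then applies, and [X] bounds the part carrying [lam i]. *)
Lemma cross_convex s s' : 0 < s -> s < s' -> s' < 1 ->
  fine (cross s) <= (1 - s / s') * X + s / s' * fine (cross s').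
Proof.
move=> s0 ss' s'1; have s'0 := lt_trans s0 ss'; have s1 := lt_trans ss' s'1.
have s01 : 0 < s < 1 by rewrite s0.
have s'01 : 0 < s' < 1 by rewrite s'0.
have t0 : 0 < s / s' by rewrite divr_gt0.
have t1 : s / s' < 1 by rewrite ltr_pdivrMr// mul1r.
have h : (fun N => (1 - s / s') * X
      + s / s' * \sum_(i < N) \sum_(j < N) wgm s' (lam i) (lam j) * F i j) @ \oo
    --> (1 - s / s') * X + s / s' * fine (cross s').
  by apply: cvgD; [exact: cvg_cst|apply: cvgMl_tmp; exact: cross_cvg].
apply: (ler_cvg_to (cross_cvg s01) h); apply: nearW => N /=.
have u0 : 0 <= 1 - s / s' by rewrite subr_ge0 ltW.
apply: le_trans (lerD (ler_wpM2l u0 (row_sum N)) (lexx _)).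
rewrite !crossN_pos// !mulr_sumr -big_split/=; apply: ler_sum => i _.
rewrite !mulr_sumr -big_split/=; apply: ler_sum => j _.
have := @wgm_young R (s / s') (lam i) (wgm s' (lam i) (lam j)).
rewrite t0 t1 => /(_ isT (lam_ge0 i) (wgm_ge0 _ _ _)).
rewrite wgm_wgm ?divfK ?gt_eqF ?s01// => /(ler_wpM2r (F_ge0 i j)).
by rewrite mulrDl !mulrA.
Qed.

End cross_sums.

Lemma EFin_dirichlet {R : realType} (h n0 n1 a b x y : R) :
  (h%:E * (n0%:E * (a%:E - x%:E) + n1%:E * (b%:E - y%:E)))%E
  = (h * (n0 * (a - x) + n1 * (b - y)))%:E.
Proof. by []. Qed.

(** The hypotheses say (a - x) / s >= (a - x') / s', and likewise for [b]: these are difference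
    quotients at 0. *)
Lemma dirichlet_convex_anti {R : realType} (n0 n1 s s' a b x y x' y' : R) :
  0 <= n0 -> 0 <= n1 -> 0 < s -> 0 < s' ->
  x <= (1 - s / s') * a + s / s' * x' -> y <= (1 - s / s') * b + s / s' * y' ->
  s'^-1 * (n0 * (a - x') + n1 * (b - y')) <= s^-1 * (n0 * (a - x) + n1 * (b - y)).
Proof.
move=> n00 n10 s0 s'0 /(ler_wpM2l n00) hx /(ler_wpM2l n10) hy.
rewrite ler_pdivlMl// mulrA; lra.
Qed.

Section functional.
Context {R : realType} (nu0 nu1 om : R).
Hypotheses (hnu0 : 0 <= nu0) (hnu1 : 0 <= nu1) (hom : 0 <= om).
Variables (lam : nat -> R) (psi : nat -> ket R).
Hypothesis lam_ge0 : forall j, 0 <= lam j.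
Hypothesis lam_sum : (\sum_(j <oo) (lam j)%:E = 1)%E.
Hypothesis orth : orthonormal_family psi.
Hypothesis hfin : finite_mean_photon lam psi.

(** [fine] sends [+oo] to 0, so [b j] is meaningful only for [psi j] in the domain of [a], which
    includes every [j] with [0 < lam j]. *)
Let b j := fine (sqnorm (annih (psi j))).
Let M i j := sqmod (inner (psi i) (annih (psi j))).
Let B := fine (mean_photon lam psi).

Let b_ge0 j : 0 <= b j.
Proof. by rewrite fine_ge0// sqnorm_ge0. Qed.

Let M_ge0 i j : 0 <= M i j.
Proof. exact: sqmod_ge0. Qed.

Let psi2 j : in_l2 (psi j). Proof. by case: orth. Qed.

Let annih2 j : 0 < lam j -> in_l2 (annih (psi j)).
Proof. by case: hfin => + _; exact. Qed.

Let psi_norm j : series (fun n => sqmod (psi j n)) @ \oo --> (1 : R).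
Proof. exact: orthonormal_sqnorm. Qed.

Let psi_norm1 j : sqnorm (psi j) = 1%E.
Proof. exact: nneseries_lim (psi_norm j). Qed.

Let creat_norm j : 0 < lam j -> sqnorm (creat (psi j)) = (b j + 1)%:E.
Proof. by move=> /annih2 h; rewrite sqnorm_creat psi_norm1 sqnormE. Qed.

Let creat2 j : 0 < lam j -> in_l2 (creat (psi j)).
Proof. by move=> h; rewrite /in_l2 creat_norm// ltry. Qed.

Let pos_le (G : nat -> R) N : (forall i, 0 <= G i) ->
  \sum_(i < N | 0 < lam i) G i <= \sum_(i < N) G i.
Proof. by move=> G0; rewrite big_mkcond; apply: ler_sum => i _; case: ifP. Qed.

Let Min N j : 0 < lam j -> \sum_(i < N | 0 < lam i) M i j <= b j.
Proof.
move=> lj; apply: (le_trans (pos_le N (M_ge0 ^~ j))).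
exact: bessel (annih2 lj).
Qed.

(** Bessel for [creat (psi i)] after passing to the adjoint; the extra 1 comes from the
    commutator. *)
Let Mout N i : 0 < lam i -> \sum_(j < N | 0 < lam j) M i j <= b i + 1.
Proof.
move=> li; have -> : b i + 1 = fine (sqnorm (creat (psi i))) by rewrite creat_norm.
apply: le_trans (bessel N orth (creat2 li)).
apply: le_trans (pos_le N (fun j => sqmod_ge0 (inner (psi j) (creat (psi i))))).
by apply: ler_sum => j lj; rewrite /M sqmod_adjoint//; [exact: creat2|exact: annih2].
Qed.

Let colP N n : \sum_(j < N | 0 < lam j) sqmod (psi j n) <= 1.
Proof.
have := bessel N orth (in_l2_fock n); rewrite /sqnorm (nneseries_lim (sqnorm_fock n))/=.
apply: le_trans.
apply: le_trans (pos_le N (fun j => sqmod_ge0 (inner (psi j) (fock R n)))).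
by apply: ler_sum => j lj; rewrite inner_fockr sqmod_conj.
Qed.

Let momP j : 0 < lam j -> series (fun n => n%:R * sqmod (psi j n)) @ \oo --> b j.
Proof.
move=> /annih2; rewrite /in_l2 /b sqnorm_annih => h.
by apply: cvg_nneseries => // n; rewrite mulr_ge0 ?sqmod_ge0.
Qed.

Let mean_photonE : mean_photon lam psi = (\sum_(j <oo) (lam j * b j)%:E)%E.
Proof.
apply: eq_eseriesr => j _; have := lam_ge0 j; rewrite le_eqVlt => /predU1P[<-|lj].
  by rewrite mul0e mul0r.
by rewrite (sqnormE (annih2 lj)) EFinM.
Qed.

Let mean_cvg : series (fun j => lam j * b j) @ \oo --> B.
Proof.
rewrite /B mean_photonE; apply: cvg_nneseries => [n|]; first by rewrite mulr_ge0.
by rewrite -mean_photonE; case: hfin.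
Qed.

Lemma mean_photon_fin : mean_photon lam psi = B%:E.
Proof. by rewrite mean_photonE (nneseries_lim mean_cvg). Qed.

Let lam_cvg : series lam @ \oo --> (1 : R).
Proof.
have -> : 1 = fine (\sum_(j <oo) (lam j)%:E)%E :> R by rewrite lam_sum.
by apply: cvg_nneseries; rewrite ?lam_sum ?ltry.
Qed.

Let anti_cvg : series (fun j => lam j * (b j + 1)) @ \oo --> B + 1.
Proof.
have -> : series (fun j => lam j * (b j + 1)) = series (fun j => lam j * b j) \+ series lam.
  by apply/funext => n; rewrite /series/= -big_split/=; apply: eq_bigr => j _; ring.
by apply: cvgD; [exact: mean_cvg|exact: lam_cvg].
Qed.

Lemma mean_anti_photon_fin : mean_anti_photon lam psi = (B + 1)%:E.
Proof.
rewrite -(nneseries_lim anti_cvg); apply: eq_eseriesr => j _.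
have := lam_ge0 j; rewrite le_eqVlt => /predU1P[<-|lj].
  by rewrite mul0e mul0r.
by rewrite (creat_norm lj) EFinM.
Qed.

Let partial_le (u : nat -> R) l N : (forall n, 0 <= u n) ->
  series u @ \oo --> l -> \sum_(i < N) u i <= l.
Proof.
move=> u0 ul; rewrite -lee_fin -(nneseries_lim ul) -sumEFin.
rewrite -(big_mkord xpredT (fun i => (u i)%:E)).
by apply: nneseries_lim_ge => n _ _; rewrite lee_fin.
Qed.

Let mean_le N : \sum_(i < N) lam i * b i <= B.
Proof. by apply: partial_le mean_cvg => n; rewrite mulr_ge0. Qed.

Let anti_le N : \sum_(i < N) lam i * (b i + 1) <= B + 1.
Proof. by apply: partial_le anti_cvg => n; rewrite mulr_ge0// addr_ge0. Qed.

Let lam_le N : \sum_(i < N) lam i <= 1.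
Proof. exact: partial_le lam_cvg. Qed.

(* [s = 1 - 1/p]; the case [p = 1] is the supremum over [s]. *)
Definition dirichlet_value s : R := s^-1 *
  (nu0 * (B + 1 - fine (cross lam M s))
   + nu1 * (B - fine (cross lam (fun i j => M j i) s))).

(** For [s = 1 - q^-1], the conjugate exponent is [s^-1]. Every term is finite, so the extended-real
    expression is a real one. *)
Lemma dirichlet_gt1_fin q : 1 < q ->
  dirichlet_gt1 nu0 nu1 q lam psi = (dirichlet_value (1 - q^-1))%:E.
Proof.
move=> q1; have q0 : 0 < q by rewrite (lt_trans ltr01).
have s01 : 0 < 1 - q^-1 < 1.
  by rewrite subr_gt0 invf_lt1// q1/= gtrBl invr_gt0 q0.
have hq : (holder_conj q)^-1 = 1 - q^-1.
  have qn : q != 0 by rewrite gt_eqF.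
  have q1n : q - 1 != 0 by rewrite gt_eqF// subr_gt0.
  by rewrite /holder_conj; field; rewrite ?qn ?q1n.
have hq' : holder_conj q = (1 - q^-1)^-1 by rewrite -hq invrK.
have qE : q^-1 = 1 - (1 - q^-1) by rewrite opprB addrCA subrr addr0.
have e1 : cross_annih q lam psi = (fine (cross lam M (1 - q^-1)))%:E.
  transitivity (cross lam M (1 - q^-1)).
    by apply: eq_eseriesr => i _; apply: eq_eseriesr => j _; rewrite hq /wgm -qE.
  exact: (cross_fin lam_ge0 M_ge0 Mout Min anti_le mean_le s01).
have e2 : cross_creat q lam psi
    = (fine (cross lam (fun i j => M j i) (1 - q^-1)))%:E.
  transitivity (cross lam (fun i j => M j i) (1 - q^-1)).
    by apply: eq_eseriesr => i _; apply: eq_eseriesr => j _; rewrite hq /wgm -qE.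
  exact: (cross_fin lam_ge0 (fun i j => M_ge0 j i) Min Mout mean_le anti_le s01).
rewrite /dirichlet_gt1 e1 e2 mean_photon_fin mean_anti_photon_fin hq'.
exact: EFin_dirichlet.
Qed.

Lemma dirichlet_value_anti s s' : 0 < s -> s < s' -> s' < 1 ->
  dirichlet_value s' <= dirichlet_value s.
Proof.
move=> s0 ss' s'1; have s'0 := lt_trans s0 ss'.
have h0 := cross_convex lam_ge0 M_ge0 Mout Min anti_le mean_le s0 ss' s'1.
have h1 := cross_convex lam_ge0 (fun i j => M_ge0 j i) Min Mout mean_le anti_le s0 ss' s'1.
exact: dirichlet_convex_anti hnu0 hnu1 s0 s'0 h0 h1.
Qed.

(** The substitution [s = 1 - q^-1] maps ]1, +oo[ increasingly onto ]0, 1[; a monotone function has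
    its supremum as right limit. *)
Lemma dirichlet_eq1_cvg : dirichlet_gt1 nu0 nu1 q lam psi @[q --> (1 : R)^'+]
  --> ereal_sup [set (dirichlet_value s)%:E | s in [set s : R | 0 < s < 1]].
Proof.
have := @nonincreasing_at_right_cvge R (fun q => dirichlet_gt1 nu0 nu1 q lam psi)
  1 +oo%O isT.
have -> : [set dirichlet_gt1 nu0 nu1 x lam psi | x in [set` `]1, +oo[]]
    = [set (dirichlet_value s)%:E | s in [set s : R | 0 < s < 1]].
  apply/seteqP; split => [_ [q /= + <-]|_ [s /= /andP[s0 s1] <-]].
    rewrite in_itv/= andbT => q1; have q0 : 0 < q by rewrite (lt_trans ltr01).
    exists (1 - q^-1); last by rewrite dirichlet_gt1_fin.
    by rewrite /= subr_gt0 invf_lt1// q1/= gtrBl invr_gt0 q0.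
  have t0 : 0 < 1 - s by rewrite subr_gt0.
  have q1 : 1 < (1 - s)^-1 by rewrite invf_gt1// gtrBl.
  have e : 1 - (1 - s)^-1^-1 = s by rewrite invrK opprB addrCA subrr addr0.
  exists (1 - s)^-1; first by rewrite /= in_itv/= andbT.
  by rewrite (dirichlet_gt1_fin q1) e.
apply => x y; rewrite !in_itv/= !andbT => x1 y1.
rewrite le_eqVlt => /predU1P[->//|xy].
rewrite (dirichlet_gt1_fin x1) (dirichlet_gt1_fin y1) lee_fin.
apply: dirichlet_value_anti.
- by rewrite subr_gt0 invf_lt1// (lt_trans ltr01).
- by rewrite ltrD2l ltrN2 ltf_pV2// posrE (lt_trans ltr01).
- by rewrite gtrBl invr_gt0 (lt_trans ltr01).
Qed.

Lemma dirichlet_eq1 : dirichlet nu0 nu1 1 lam psi =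
  ereal_sup [set (dirichlet_value s)%:E | s in [set s : R | 0 < s < 1]].
Proof. by rewrite /dirichlet eqxx; exact: cvg_lim dirichlet_eq1_cvg. Qed.

(** [truncated_bound] holds for each [N], and both of its sides converge when the entropy is finite;
    infinite entropy makes the claim trivial. *)
Lemma dirichlet_value_bound m s : 0 < s < 1 ->
  (forall x, 0 <= x < 1 -> m * (1 - x) <= thermal_value nu0 nu1 om s x) ->
  (m%:E <= (dirichlet_value s)%:E + om%:E * mean_photon lam psi + entropy lam)%E.
Proof.
move=> s01 hm; rewrite mean_photon_fin -EFinM -EFinD.
have ent0 j : 0 <= - (lam j * ln (lam j)).
  rewrite oppr_ge0 xlnx_le0// lam_ge0/=; have := lam_le j.+1.
  by apply: le_trans; rewrite big_ord_recr/= lerDr sumr_ge0.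
have [ent|/negbNE/eqP ent] := boolP (entropy lam != +oo%E); last first.
  by rewrite ent addey// leey.
have entf : entropy lam \is a fin_num.
  rewrite ge0_fin_numE ?lt_neqAle ?ent ?leey//.
  by apply: nneseries_ge0 => j _ _; rewrite lee_fin.
have entc : series (fun j => - (lam j * ln (lam j))) @ \oo --> fine (entropy lam).
  by apply: cvg_nneseries => //; rewrite -/(entropy lam) ltey.
rewrite -(fineK entf) -EFinD lee_fin -[m]mulr1.
have cA := cross_cvg lam_ge0 M_ge0 Mout Min anti_le mean_le s01.
have cB := cross_cvg lam_ge0 (fun i j => M_ge0 j i) Min Mout mean_le anti_le s01.
have c1 : (fun N => m * series lam N) @ \oo --> m * 1 by exact: cvgMl_tmp.
have c4 : (fun N => s^-1 *
     (nu0 * (series (fun j => lam j * (b j + 1)) N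
             - \sum_(i < N) \sum_(j < N) wgm s (lam i) (lam j) * M i j)
      + nu1 * (series (fun j => lam j * b j) N
             - \sum_(i < N) \sum_(j < N) wgm s (lam i) (lam j) * M j i))
     + om * series (fun j => lam j * b j) N
     + series (fun j => - (lam j * ln (lam j))) N) @ \oo -->
    dirichlet_value s + om * B + fine (entropy lam).
  apply: cvgD; last exact: entc.
  apply: cvgD; last by apply: cvgMl_tmp; exact: mean_cvg.
  apply: cvgMl_tmp; apply: cvgD; apply: cvgMl_tmp; apply: cvgB.
  - exact: anti_cvg.
  - exact: cA.
  - exact: mean_cvg.
  - exact: cB.
apply: (ler_cvg_to c1 c4); apply: nearW => N.
rewrite /series/= !big_mkord.
exact: (truncated_bound hnu0 hnu1 hom s01 lam_ge0 hm (lam_le N) M_ge0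
  (fun j n => sqmod_ge0 (psi j n)) (Mout N) (Min N) (colP N)
  (fun j _ => psi_norm j) momP).
Qed.

End functional.

(** * Thermal states *)

Section thermal_state.
Context {R : realType} (nu0 nu1 om x : R).
Hypotheses (hnu0 : 0 <= nu0) (hnu1 : 0 <= nu1) (hom : 0 <= om) (x01 : 0 < x < 1).

Let x0 : 0 < x. Proof. by case/andP: x01. Qed.
Let x1 : x < 1. Proof. by case/andP: x01. Qed.
Let y0 : 0 < 1 - x. Proof. by rewrite subr_gt0. Qed.

Let lam := thermal_eigenvalue x.

Let lam_gt0 n : 0 < lam n.
Proof. by rewrite mulr_gt0 ?exprn_gt0. Qed.

Let lam_ge0 n : 0 <= lam n. Proof. exact: ltW. Qed.

Let lamS n : lam n.+1 = lam n * x.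
Proof. by rewrite /lam /thermal_eigenvalue exprSr mulrA. Qed.

Let lam_cvg : series lam @ \oo --> (1 : R).
Proof.
have := @cvg_geometric_series R (1 - x) x.
by rewrite mulfV ?gt_eqF// ger0_norm ?ltW//; apply.
Qed.

Let lam_sum : (\sum_(j <oo) (lam j)%:E = 1)%E.
Proof. exact: nneseries_lim lam_cvg. Qed.

Let mom n := n%:R * lam n.

Let mom_ge0 n : 0 <= mom n. Proof. by rewrite mulr_ge0. Qed.

(** This recursion bounds the partial sums by x / (1 - x) and, in the limit, determines the mean
    photon number as the fixed point of B = x (B + 1). *)
Let momS Q : series mom Q.+1 = x * (series mom Q + series lam Q).
Proof.
rewrite /series/= big_nat_recl// {1}/mom mul0r add0r -big_split/= mulr_sumr.
by apply: eq_bigr => n _; rewrite /mom lamS -natr1; ring.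
Qed.

Let mom_lt : (\sum_(n <oo) (mom n)%:E < +oo)%E.
Proof.
apply: (@le_lt_trans _ _ (x / (1 - x))%:E); last exact: ltry.
apply: lime_le; first by apply: is_cvg_nneseries => n _ _; rewrite lee_fin.
apply: nearW => Q; rewrite sumEFin lee_fin ler_pdivlMr//.
rewrite (_ : \sum_(0 <= i < Q) mom i = series mom Q)//.
have : series mom Q <= series mom Q.+1 by rewrite /series/= big_nat_recr//= lerDl.
have : series lam Q <= 1.
  rewrite -lee_fin -[X in (_ <= X)%E]lam_sum /series/= -sumEFin.
  by apply: nneseries_lim_ge => n _ _; rewrite lee_fin.
rewrite momS; move: (series mom Q) (series lam Q) => S L hL hS.
by have := ler_wpM2l (ltW x0) hL; lra.
Qed.

Let mom_cvg : series mom @ \oo --> x / (1 - x).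
Proof.
have h := cvg_nneseries mom_ge0 mom_lt.
suff <- : fine (\sum_(n <oo) (mom n)%:E)%E = x / (1 - x) by [].
move: h; set B := fine _ => h.
have h1 : series mom \o S @ \oo --> x * (B + 1).
  have -> : series mom \o S = (fun Q => x * (series mom Q + series lam Q)).
    by apply/funext => Q; exact: momS.
  by apply: cvgMl_tmp; apply: cvgD; [exact: h|exact: lam_cvg].
have h2 : series mom \o S @ \oo --> B by rewrite (cvg_shiftS (series mom)).
have : B = x * (B + 1) by rewrite -(cvg_lim _ h1)// (cvg_lim _ h2).
have n0 : 1 - x != 0 by rewrite gt_eqF.
by move=> e; apply: (canRL (mulfK n0)); lra.
Qed.

Let anti_cvg : series (fun n => n.+1%:R * lam n) @ \oo --> (1 - x)^-1.
Proof.
have -> : (1 - x)^-1 = x / (1 - x) + 1 by field; rewrite gt_eqF.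
have -> : series (fun n => n.+1%:R * lam n) = series mom \+ series lam.
  apply/funext => n; rewrite /series/= -big_split/=; apply: eq_bigr => j _.
  by rewrite /mom -natr1; ring.
by apply: cvgD; [exact: mom_cvg|exact: lam_cvg].
Qed.

Let annih_fock j : sqnorm (annih (@fock R j)) = (j%:R)%:E.
Proof.
rewrite sqnorm_annih; apply: nneseries_lim.
have -> : j%:R = (fun n => n%:R * sqmod (@fock R j n)) j.
  by rewrite /fock eqxx sqmod_nat mulr1.
by apply: series_single => n /negbTE nj; rewrite /fock nj sqmod_nat mulr0.
Qed.

Let thermal_photon : mean_photon lam (@fock R) = (x / (1 - x))%:E.
Proof.
rewrite -(nneseries_lim mom_cvg); apply: eq_eseriesr => j _.
by rewrite annih_fock -EFinM mulrC.
Qed.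

Let thermal_fin : finite_mean_photon lam (@fock R).
Proof.
split=> [j _|]; first by rewrite /in_l2 annih_fock ltry.
by rewrite thermal_photon ltry.
Qed.

Let overlap i j : sqmod (inner (fock R i) (annih (fock R j)))
  = i.+1%:R * (i.+1 == j)%:R.
Proof. by rewrite inner_fockl sqmod_annih /fock sqmod_nat. Qed.

Let nneseries_single (u : nat -> R) m : (forall n, n != m -> u n = 0) ->
  (\sum_(n <oo) (u n)%:E = (u m)%:E)%E.
Proof. by move=> u0; apply: nneseries_lim; exact: series_single. Qed.

Let thermal_cross s :
  cross lam (fun i j => sqmod (inner (fock R i) (annih (fock R j)))) s
  = (x `^ s / (1 - x))%:E.
Proof.
rewrite /cross.
under eq_eseriesr => i _.
  rewrite (@nneseries_single _ i.+1) => [|j ji]; last first.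
    by rewrite overlap eq_sym (negbTE ji) !mulr0.
  rewrite overlap eqxx mulr1 lamS -{1}[lam i]mulr1 wgmM ?lam_ge0 ?ltW//.
  rewrite wgm_diag// /wgm powR1 mul1r.
  over.
apply: nneseries_lim.
have -> : series (fun i => lam i * x `^ s * i.+1%:R)
    = (fun Q => x `^ s * series (fun n => n.+1%:R * lam n) Q).
  by apply/funext => Q; rewrite /series/= mulr_sumr; apply: eq_bigr => n _; ring.
by apply: cvgMl_tmp; exact: anti_cvg.
Qed.

(** The sums are exchanged first, so that each inner sum has the single nonzero term [i = j.+1]; the
    ratio [x] now sits in the first argument of [wgm], hence the exponent [1 - s]. *)
Let thermal_cross_tr s :
  cross lam (fun i j => sqmod (inner (fock R j) (annih (fock R i)))) s
  = (x `^ (1 - s) / (1 - x))%:E.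
Proof.
rewrite /cross nneseries_interchange; last first.
  by move=> i j; rewrite lee_fin mulr_ge0 ?wgm_ge0 ?sqmod_ge0.
under eq_eseriesr => j _.
  rewrite (@nneseries_single (fun i => wgm s (lam i) (lam j) *
    sqmod (inner (fock R j) (annih (fock R i)))) j.+1) => [|i ij]; last first.
    by rewrite overlap eq_sym (negbTE ij) !mulr0.
  rewrite overlap eqxx mulr1 lamS -{2}[lam j]mulr1 wgmM ?lam_ge0 ?ltW//.
  rewrite wgm_diag// /wgm powR1 mulr1.
  over.
apply: nneseries_lim.
have -> : series (fun i => lam i * x `^ (1 - s) * i.+1%:R)
    = (fun Q => x `^ (1 - s) * series (fun n => n.+1%:R * lam n) Q).
  by apply/funext => Q; rewrite /series/= mulr_sumr; apply: eq_bigr => n _; ring.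
by apply: cvgMl_tmp; exact: anti_cvg.
Qed.

Let thermal_entropy : entropy lam = (hbin x / (1 - x))%:E.
Proof.
apply: nneseries_lim.
have -> : series (fun j => - (lam j * ln (lam j))) =
    (fun Q => - ln (1 - x) * series lam Q + - ln x * series mom Q).
  apply/funext => Q; rewrite /series/= !mulr_sumr -big_split/=; apply: eq_bigr => n _.
  rewrite /mom {2}/lam /thermal_eigenvalue lnM ?posrE ?exprn_gt0// lnXn//.
  by rewrite -mulr_natl; ring.
have -> : hbin x / (1 - x) = - ln (1 - x) * 1 + - ln x * (x / (1 - x)).
  by rewrite /hbin; field; rewrite gt_eqF.
by apply: cvgD; apply: cvgMl_tmp; [exact: lam_cvg|exact: mom_cvg].
Qed.

Lemma thermal_functional s :
  ((dirichlet_value nu0 nu1 lam (@fock R) s)%:E + om%:E * mean_photon lam (@fock R)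
   + entropy lam = (thermal_value nu0 nu1 om s x / (1 - x))%:E)%E.
Proof.
rewrite thermal_entropy thermal_photon -EFinM -!EFinD; congr (_%:E).
rewrite /dirichlet_value thermal_photon thermal_cross thermal_cross_tr /=.
by rewrite /thermal_value; move: (s^-1) => t; field; rewrite gt_eqF.
Qed.

Lemma Upsilon_thermal_gt1 p : 1 < p ->
  Upsilon nu0 nu1 om p lam (@fock R)
  = (thermal_value nu0 nu1 om (1 - p^-1) x / (1 - x))%:E.
Proof.
move=> p1; rewrite /Upsilon /dirichlet gt_eqF//.
rewrite (dirichlet_gt1_fin _ _ lam_ge0 lam_sum (@orthonormal_fock R) thermal_fin p1).
exact: thermal_functional.
Qed.

(** Each member of the supremum over [s] is bounded by [thermal_value_le0]; a lower bound for the
    values at thermal states thus passes to [thermal_value0]. *)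
Lemma Upsilon_thermal_eq1 :
  (Upsilon nu0 nu1 om 1 lam (@fock R)
   <= (thermal_value0 nu0 nu1 om x / (1 - x))%:E)%E.
Proof.
rewrite /Upsilon (dirichlet_eq1 hnu0 hnu1 lam_ge0 lam_sum (@orthonormal_fock R) thermal_fin).
have tf s := thermal_functional s.
rewrite thermal_entropy thermal_photon -EFinM in tf *; rewrite -addeA -EFinD.
set r := om * _ + _; set X := _ / _.
have supX : (ereal_sup [set (dirichlet_value nu0 nu1 lam (@fock R) s)%:E
    | s in [set s : R | (0 < s < 1)%R]] <= (X - r)%:E)%E.
  apply: ub_ereal_sup => _ [s /= s01 <-]; rewrite lee_fin lerBrDr.
  have := tf s; rewrite -addeA -!EFinD => -[->].
  by rewrite ler_pM2r ?invr_gt0// thermal_value_le0.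
by apply: le_trans (leeD2r _ supX) _; rewrite -EFinD subrK.
Qed.

End thermal_state.

(** * Comparison of an arbitrary state with the thermal states *)

Theorem theorem1 (R : realType) (nu0 nu1 omega p : R)
    (hnu0 : 0 <= nu0) (hnu1 : 0 <= nu1) (homega : 0 <= omega) (hp : 1 <= p)
    (rho : ket R -> ket R) (lam : nat -> R) (psi : nat -> ket R)
    (hrho : state rho)
    (hdec : eigen_decomposition rho lam psi)
    (hfin : finite_mean_photon lam psi) :
  (eta_th nu0 nu1 omega p <= Upsilon nu0 nu1 omega p lam psi)%E.
Proof.
have [_ rho_ge0 tr_rho] := hrho.
have lam_ge0 j : 0 <= lam j by exact: (eigenvalue_ge0 hdec).
have lam_sum := eigenvalue_sum hdec lam_ge0 tr_rho.
have [orth _] := hdec.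
have eta_le (x : R) : 0 < x < 1 -> (eta_th nu0 nu1 omega p <=
    Upsilon nu0 nu1 omega p (thermal_eigenvalue x) (@fock R))%E.
  by move=> x01; apply: ereal_inf_lbound; exists x.
move: hp eta_le; rewrite le_eqVlt => /predU1P[<-|p1].
  (* For [p = 1] a loss [e] buys a single [s] that works for all [x]; the first term is a supremum
     over [s], hence at least its value there. *)
  case: (eta_th nu0 nu1 omega 1) => [m||] eta_le; last by rewrite leNye.
    apply/lee_addgt0Pr => e e0.
    have [|s s01 hs] := thermal_value_uniform (om := omega) (m := m) hnu0 hnu1 homega e0.
      move=> x x01; have /andP[_ x1] := x01; rewrite -ler_pdivlMr ?subr_gt0//.
      by rewrite -lee_fin; apply: le_trans (eta_le x x01) _; exact: Upsilon_thermal_eq1.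
    have := dirichlet_value_bound hnu0 hnu1 homega lam_ge0 lam_sum orth hfin s01 hs.
    rewrite EFinB leeBlDr// => /le_trans; apply; rewrite leeD2r//.
    rewrite /Upsilon !leeD2r// (dirichlet_eq1 hnu0 hnu1 lam_ge0 lam_sum orth hfin).
    by apply: ereal_sup_ubound; exists s.
  (* An infimum [+oo] contradicts the finite bound at the thermal state with [x = 2^-1]. *)
  have h12 : 0 < (2^-1 : R) < 1 by apply/andP; split; lra.
  have : (+oo <= (thermal_value0 nu0 nu1 omega 2^-1 / (1 - 2^-1))%:E)%E.
    by apply: le_trans (eta_le _ h12) _; exact: Upsilon_thermal_eq1.
  by rewrite leye_eq.
case: (eta_th nu0 nu1 omega p) => [m||] eta_le; last by rewrite leNye.
  have s01 : 0 < 1 - p^-1 < 1.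
    have p0 : 0 < p by rewrite (lt_trans ltr01).
    by rewrite subr_gt0 invf_lt1// p1/= gtrBl invr_gt0 p0.
  rewrite /Upsilon /dirichlet gt_eqF//.
  rewrite (dirichlet_gt1_fin _ _ lam_ge0 lam_sum orth hfin p1).
  apply: dirichlet_value_bound => //; apply: thermal_value_bound0 => // x x01.
  have /andP[_ x1] := x01; rewrite -ler_pdivlMr ?subr_gt0//.
  by have := eta_le x x01; rewrite Upsilon_thermal_gt1// lee_fin.
have h12 : 0 < (2^-1 : R) < 1 by apply/andP; split; lra.
by have := eta_le _ h12; rewrite Upsilon_thermal_gt1// leye_eq.
Qed.
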